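(* Let $W\subset GL(V)$ be a finite complex reflection group, $k=\{k_{H,i}\}$ an integral multiplicity, and $\tau\in\mathrm{Irr}(W)$. Then there is an isomorphism of $H_k$-modules $\mathbf{Q}_k(\tau)\cong M_k(\tau')$, where $\tau=\mathrm{kz}_k(\tau')$.
   Context: Let $V$ be a finite-dimensional complex vector space and $W\subset GL(V)$ a finite group generated by complex reflections; $\mathrm{Irr}(W)$ is the set of isomorphism classes of irreducible complex representations. $\mathcal{A}$ is the set of reflection hyperplanes; for $H\in\mathcal{A}$, $W_H$ is the pointwise stabilizer (cyclic of order $n_H$), $\alpha_H\in V^*$ has kernel $H$, and $e_{H,i}=\frac{1}{n_H}\sum_{w\in W_H}(\det w)^{-i}w\in\mathbb{C}W$ ($\det$ = determinant on $V$). An integral multiplicity $k=\{k_{H,i}\}$, $0\le i\le n_H-1$, consists of integers $k_{H,i}$ depending only on $i$ and the $W$-orbit of $H$. $V_{\mathrm{reg}}=V\setminus\bigcup_H H$, $\mathcal{D}W=\mathcal{D}(V_{\mathrm{reg}})*W$ (crossed product). Dunkl operators: $T_{\xi}=\partial_\xi-\sum_{H}\frac{\alpha_H(\xi)}{\alpha_H}\sum_{i=0}^{n_H-1}n_Hk_{H,i}e_{H,i}$, $\xi\in V$. $H_k$ is the subalgebra of $\mathcal{D}W$ generated by $\mathbb{C}[V]$, $\mathbb{C}W$ and the commuting operators $T_\xi$ (which generate a copy of $\mathbb{C}[V^*]$). The standard module is $M_k(\tau)=H_k\otimes_{\mathbb{C}[V^*]*W}\tau$, with $\xi\in V$ acting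 on $\tau$ by $0$. $\mathcal{D}W$ (hence $H_k$) acts on $\mathbb{C}[V_{\mathrm{reg}}]\otimes\tau$ by $g(f\otimes u)=gf\otimes u$ ($g\in\mathbb{C}[V_{\mathrm{reg}}]$), $\partial_\xi(f\otimes u)=\partial_\xi f\otimes u$, $w(f\otimes u)=f(w^{-1}\,\cdot)\otimes wu$. The module of $\tau$-valued quasi-invariants $\mathbf{Q}_k(\tau)\subset\mathbb{C}[V_{\mathrm{reg}}]\otimes\tau$ is the set of $\varphi$ with $(1\otimes e_{H,i})\varphi\equiv0\bmod\langle\alpha_H\rangle^{n_Hk_{H,i}}\otimes\tau$ for all $H\in\mathcal{A}$, $0\le i\le n_H-1$, where this congruence means that $\alpha_H^{-n_Hk_{H,i}}(1\otimes e_{H,i})\varphi$ is regular along $H$ (possibly with poles along other hyperplanes). It is an $H_k$-submodule. KZ twists: for $\sigma\in\mathrm{Irr}(W)$, the KZ system for $\sigma$-valued $y$ on $V_{\mathrm{reg}}$ is $\partial_\xi y+\sum_{H}\frac{\alpha_H(\xi)}{\alpha_H}\sum_{i=0}^{n_H-1}n_Hk_{H,i}\,e_{H,i}(y)=0$, $\xi\in V$ (with $e_{H,i}$ acting on values). For integral $k$ all local solutions extend to global ones in $\mathbb{C}[V_{\mathrm{reg}}]\otimes\sigma$; these form a space of dimension $\dim\sigma$ carrying the irreducible $W$-action $({}^wy)(x)=w\,(y(w^{-1}x))$. Its class is $\mathrm{kz}_k(\sigma)$; $\mathrm{kz}_k$ is a permutation of $\mathrm{Irr}(W)$. *)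

(* Defs.v *)
From HB Require Import structures.
From mathcomp Require Import all_boot all_order all_fingroup all_algebra.
From mathcomp Require Import all_field all_character.
From mathcomp Require Import boolp reals.
From mathcomp Require Import complex mpoly ring.

Set Implicit Arguments.
Unset Strict Implicit.
Unset Printing Implicit Defensive.

Import GRing.Theory.
Local Open Scope ring_scope.

(* MathComp, with MathComp-Analysis for [realType] and classical logic.

   Everything below is developed over a field [C], to be instantiated with
   [R[i]] for [R : realType].  The space [V] is ['cV[C]_n], and a subgroup of
   [GL(V)] is given by a faithful matrix representation [W], the element [w]
   acting on [V] by [v |-> W w *m v]. *)

Section LinearEndomorphisms.
Variables (A : pzRingType) (U : lmodType A).

Definition lendo : Type := {linear U -> U}.
HB.instance Definition _ := gen_eqMixin lendo.
HB.instance Definition _ := gen_choiceMixin lendo.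

Implicit Types f g h : lendo.
Definition lendo_fun f : U -> U := GRing.Linear.sort f.
Coercion lendo_fun : lendo >-> Funclass.
HB.instance Definition _ f := GRing.Linear.copy (lendo_fun f) (GRing.Linear.sort f).

Lemma lendoP f g : f =1 g -> f = g.
Proof.
move=> fg; have : lendo_fun f = lendo_fun g by apply/funext.
rewrite /lendo_fun; case: f {fg} => f cf; case: g => g cg /= E.
move: cf; rewrite E => cf {E f}; congr GRing.Linear.Pack.
case: cf => [[a1] [b1]]; case: cg => [[a2] [b2]].
by rewrite (Prop_irrelevance a1 a2) (Prop_irrelevance b1 b2).
Qed.

Fact lendo_zero_linear : linear (fun _ : U => 0 : U).
Proof. by move=> a x y; rewrite scaler0 addr0. Qed.
Fact lendo_opp_linear f : linear (fun x => - f x).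
Proof. by move=> a x y; rewrite linearP opprD scalerN. Qed.
Fact lendo_add_linear f g : linear (fun x => f x + g x).
Proof. by move=> a x y; rewrite !linearP scalerDr addrACA. Qed.
Fact lendo_one_linear : linear (fun x : U => x).
Proof. by []. Qed.
Fact lendo_mul_linear f g : linear (fun x => f (g x)).
Proof. by move=> a x y; rewrite !linearP. Qed.

Definition mk_lendo (f : U -> U) (fP : linear f) : lendo :=
  HB.pack_for {linear U -> U} f (GRing.isLinear.Build A U U *:%R f fP).
Lemma mk_lendoE (f : U -> U) (fP : linear f) x : mk_lendo fP x = f x.
Proof. by []. Qed.

Definition lendo_zero := mk_lendo lendo_zero_linear.
Definition lendo_opp f := mk_lendo (lendo_opp_linear f).
Definition lendo_add f g := mk_lendo (lendo_add_linear f g).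
Definition lendo_one := mk_lendo lendo_one_linear.
Definition lendo_mul f g := mk_lendo (lendo_mul_linear f g).

Fact lendo_addA : associative lendo_add.
Proof. by move=> f g h; apply: lendoP => x; apply: addrA. Qed.
Fact lendo_addC : commutative lendo_add.
Proof. by move=> f g; apply: lendoP => x; apply: addrC. Qed.
Fact lendo_add0 : left_id lendo_zero lendo_add.
Proof. by move=> f; apply: lendoP => x; apply: add0r. Qed.
Fact lendo_addN : left_inverse lendo_zero lendo_opp lendo_add.
Proof. by move=> f; apply: lendoP => x; apply: addNr. Qed.
HB.instance Definition _ := GRing.isZmodule.Build lendo
  lendo_addA lendo_addC lendo_add0 lendo_addN.

Fact lendo_mulA : associative lendo_mul.
Proof. by move=> f g h; apply: lendoP. Qed.
Fact lendo_mul1 : left_id lendo_one lendo_mul.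
Proof. by move=> f; apply: lendoP. Qed.
Fact lendo_mulr1 : right_id lendo_one lendo_mul.
Proof. by move=> f; apply: lendoP. Qed.
Fact lendo_mulDl : left_distributive lendo_mul +%R.
Proof. by move=> f g h; apply: lendoP. Qed.
Fact lendo_mulDr : right_distributive lendo_mul +%R.
Proof. by move=> f g h; apply: lendoP => x; apply: linearD. Qed.
HB.instance Definition _ := GRing.Zmodule_isPzRing.Build lendo
  lendo_mulA lendo_mul1 lendo_mulr1 lendo_mulDl lendo_mulDr.

Lemma lendo0E x : (0 : lendo) x = 0. Proof. by []. Qed.
Lemma lendoDE f g x : (f + g) x = f x + g x. Proof. by []. Qed.
Lemma lendoNE f x : (- f) x = - f x. Proof. by []. Qed.
Lemma lendo1E x : (1 : lendo) x = x. Proof. by []. Qed.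
Lemma lendoME f g x : (f * g) x = f (g x). Proof. by []. Qed.
End LinearEndomorphisms.
Arguments lendo {A} U.

Section GeneratedSubring.
Variables (A : pzRingType) (S : A -> Prop).

Inductive subring_span : A -> Prop :=
| Span_gen x : S x -> subring_span x
| Span_one : subring_span 1
| Span_sub x y : subring_span x -> subring_span y -> subring_span (x - y)
| Span_mul x y : subring_span x -> subring_span y -> subring_span (x * y).

Definition in_subring_span : pred A := fun x => `[< subring_span x >].

Fact in_subring_span_closed : subring_closed in_subring_span.
Proof.
by split=> [|x y /asboolP hx /asboolP hy|x y /asboolP hx /asboolP hy];
  apply/asboolP; [exact: Span_one|exact: Span_sub|exact: Span_mul].
Qed.
HB.instance Definition _ :=
  GRing.isSubringClosed.Build A in_subring_span in_subring_span_closed.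

Record generated_subring : Type :=
  GeneratedSubring { gs_val :> A; _ : in_subring_span gs_val }.
HB.instance Definition _ := [isSub for gs_val].
HB.instance Definition _ := [Choice of generated_subring by <:].
HB.instance Definition _ := GRing.SubChoice_isSubPzRing.Build A in_subring_span
  generated_subring in_subring_span_closed.

Definition gs_gen x (Sx : S x) : generated_subring :=
  GeneratedSubring (asboolT (Span_gen Sx)).
End GeneratedSubring.

Section QuotientModule.
Variables (A : pzRingType) (M : lmodType A) (S : M -> Prop).

Inductive submod_span : M -> Prop :=
| Mspan_gen x : S x -> submod_span x
| Mspan_zero : submod_span 0
| Mspan_lin a x y : submod_span x -> submod_span y -> submod_span (a *: x + y).

Definition in_submod_span : pred M := fun x => `[< submod_span x >].

Fact in_submod_span_zmod : zmod_closed in_submod_span.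
Proof.
split=> [|x y /asboolP hx /asboolP hy]; apply/asboolP; first exact: Mspan_zero.
by rewrite addrC -scaleN1r; apply: Mspan_lin.
Qed.
HB.instance Definition _ :=
  GRing.isZmodClosed.Build M in_submod_span in_submod_span_zmod.

Fact in_submod_spanZ a x : in_submod_span x -> in_submod_span (a *: x).
Proof.
move=> /asboolP hx; apply/asboolP; rewrite -[_ *: _]addr0.
by apply: Mspan_lin => //; apply: Mspan_zero.
Qed.

(* The quotient of [M] by the [A]-submodule generated by [S]. *)
Definition span_zmodClosed : zmodClosed M := GRing.ZmodClosed.clone M in_submod_span _.
Definition quotient_module : Type := Quotient.quot span_zmodClosed.
HB.instance Definition _ := GRing.Zmodule.on quotient_module.

Definition qm_proj (x : M) : quotient_module :=
  \pi_(Quotient.quot span_zmodClosed)%qT x.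

Lemma qm_projP x y : (qm_proj x = qm_proj y) <-> submod_span (x - y).
Proof.
split=> [/eqP|h]; last apply/eqP.
  by rewrite -Quotient.idealrBE => /asboolP.
by rewrite -Quotient.idealrBE; apply/asboolP.
Qed.

Lemma qm_repr q : qm_proj (generic_quotient.repr q) = q. Proof. exact: reprK. Qed.

Fact qm_proj_is_zmod_morphism : zmod_morphism qm_proj.
Proof.
move=> x y; rewrite /qm_proj.
by rewrite [RHS]/GRing.add/= [in RHS]/GRing.opp/= -Quotient.pi_opp -Quotient.pi_add.
Qed.
HB.instance Definition _ := GRing.isZmodMorphism.Build M quotient_module qm_proj
  qm_proj_is_zmod_morphism.

Definition qm_scale (a : A) (q : quotient_module) := qm_proj (a *: generic_quotient.repr q).

Lemma qm_scaleE a x : qm_scale a (qm_proj x) = qm_proj (a *: x).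
Proof.
apply/qm_projP; rewrite -scalerBr; apply/asboolP/in_submod_spanZ/asboolP.
by apply/qm_projP; rewrite qm_repr.
Qed.

Fact qm_scaleA a b q : qm_scale a (qm_scale b q) = qm_scale (a * b) q.
Proof. by rewrite -[q]qm_repr !qm_scaleE scalerA. Qed.
Fact qm_scale1 : left_id 1 qm_scale.
Proof. by move=> q; rewrite -[q]qm_repr !qm_scaleE scale1r. Qed.
Fact qm_scaleDr : right_distributive qm_scale +%R.
Proof.
move=> a p q; rewrite -[p]qm_repr -[q]qm_repr -raddfD !qm_scaleE.
by rewrite scalerDr raddfD.
Qed.
Fact qm_scaleDl q : {morph qm_scale^~ q : a b / a + b}.
Proof. by move=> a b; rewrite -[q]qm_repr !qm_scaleE scalerDl raddfD. Qed.
HB.instance Definition _ := GRing.Zmodule_isLmodule.Build A quotient_module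
  qm_scaleA qm_scale1 qm_scaleDr qm_scaleDl.
Fact qm_proj_is_scalable : scalable qm_proj.
Proof. by move=> a x; rewrite -qm_scaleE. Qed.
HB.instance Definition _ := GRing.isScalable.Build A M quotient_module *:%R qm_proj
  qm_proj_is_scalable.
End QuotientModule.

Section CrossedProduct.
Variables (A : pzRingType) (gT : finGroupType).

Record ring_action : Type := RingAction {
  ra_fun : gT -> {rmorphism A -> A};
  ra_1 : forall x, ra_fun 1%g x = x;
  ra_M : forall g h x, ra_fun (g * h)%g x = ra_fun g (ra_fun h x) }.

(* The family [x : {ffun gT -> A}] stands for the formal sum of the [x g * g],
   subject to [g * a = (g .: a) * g]. *)
Definition crossed (_ : ring_action) : Type := {ffun gT -> A}.
HB.instance Definition _ act := GRing.Zmodule.on (crossed act).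

Variable act : ring_action.
Local Notation "g .: x" := (ra_fun act g x) (at level 35).
Local Notation AG := (crossed act).

Definition crossed_one : AG := [ffun g => (g == 1%g)%:R].
Definition crossed_mul (x y : AG) : AG :=
  [ffun g => \sum_h x h * (h .: y (h^-1 * g)%g)].

Fact crossed_mulA : associative crossed_mul.
Proof.
move=> x y z; apply/ffunP => g; rewrite !ffunE.
under eq_bigr => h _ do rewrite ffunE rmorph_sum mulr_sumr.
under [RHS]eq_bigr => h _ do rewrite ffunE mulr_suml.
rewrite [RHS]exchange_big /=; apply: eq_bigr => h _.
rewrite (reindex_inj (mulgI h^-1%g)) /=; apply: eq_bigr => u _.
by rewrite rmorphM mulrA -ra_M mulKVg invMg invgK -!mulgA mulKVg.
Qed.
Fact crossed_mul1 : left_id crossed_one crossed_mul.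
Proof.
move=> x; apply/ffunP => g; rewrite ffunE (bigD1 1%g) //= big1 => [|h /negPf h1].
  by rewrite ffunE eqxx mul1r ra_1 invg1 mul1g addr0.
by rewrite ffunE h1 mul0r.
Qed.
Fact crossed_mulr1 : right_id crossed_one crossed_mul.
Proof.
move=> x; apply/ffunP => g; rewrite ffunE (bigD1 g) //= big1 => [|h /negPf h1].
  by rewrite ffunE mulVg eqxx rmorph1 mulr1 addr0.
by rewrite ffunE -eq_mulVg1 h1 rmorph0 mulr0.
Qed.
Fact crossed_mulDl : left_distributive crossed_mul +%R.
Proof.
move=> x y z; apply/ffunP => g; rewrite !ffunE -big_split /=.
by apply: eq_bigr => h _; rewrite ffunE mulrDl.
Qed.
Fact crossed_mulDr : right_distributive crossed_mul +%R.
Proof.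
move=> x y z; apply/ffunP => g; rewrite !ffunE -big_split /=.
by apply: eq_bigr => h _; rewrite ffunE rmorphD mulrDr.
Qed.
HB.instance Definition _ := GRing.Zmodule_isPzRing.Build AG
  crossed_mulA crossed_mul1 crossed_mulr1 crossed_mulDl crossed_mulDr.

Definition crossed_coef (a : A) : AG := [ffun g => if g == 1%g then a else 0].
Definition crossed_grp (w : gT) : AG := [ffun g => (g == w)%:R].
End CrossedProduct.

Local Notation "x %:F" := (tofrac x).

Section FractionExtension.
Variable D : idomainType.
Implicit Types (a b c d : D) (x y : {fraction D}).

Definition fnum x : D := \n_(generic_quotient.repr x).
Definition fden x : D := \d_(generic_quotient.repr x).

Lemma fden_neq0 x : fden x != 0. Proof. exact: denom_ratioP. Qed.

Lemma frac_numden x : x = (fnum x)%:F / (fden x)%:F.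
Proof.
apply: (canRL (mulfK _)); first by rewrite tofrac_eq0 fden_neq0.
rewrite -{1}[x]generic_quotient.reprK /fnum /fden.
set r := generic_quotient.repr x.
rewrite !piE; apply/eqP; rewrite piE /= FracField.equivfE /FracField.mulf.
rewrite !numden_Ratio ?oner_eq0 ?mulf_neq0 ?denom_ratioP ?oner_neq0 //.
by rewrite !mulr1 mulrC.
Qed.

Lemma fracP x : exists a b, b != 0 /\ x = a%:F / b%:F.
Proof. by exists (fnum x), (fden x); split; [exact: fden_neq0|exact: frac_numden]. Qed.

Lemma eq_frac a b c d : b != 0 -> d != 0 ->
  (a%:F / b%:F == c%:F / d%:F) = (a * d == c * b).
Proof. by move=> b0 d0; rewrite eqr_div ?tofrac_eq0 // -!tofracM tofrac_eq. Qed.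

Section Morphism.
Variables (f : {rmorphism D -> D}) (f_inj : injective f).

Definition frac_map x := (f (fnum x))%:F / (f (fden x))%:F.

Lemma frac_mapE a b : b != 0 -> frac_map (a%:F / b%:F) = (f a)%:F / (f b)%:F.
Proof.
move=> b0; rewrite /frac_map; set x := a%:F / b%:F.
have f0 c : c != 0 -> f c != 0 by rewrite -[c == 0](inj_eq f_inj) rmorph0.
apply/eqP; rewrite eq_frac ?f0 ?fden_neq0 // -!rmorphM (inj_eq f_inj).
by rewrite -eq_frac ?fden_neq0 // -frac_numden.
Qed.

Fact frac_map_is_zmod_morphism : zmod_morphism frac_map.
Proof.
move=> x y; have [a [b [b0 ->]]] := fracP x; have [c [d [d0 ->]]] := fracP y.
have f0 e : e != 0 -> f e != 0 by rewrite -[e == 0](inj_eq f_inj) rmorph0.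
rewrite -mulNr -tofracN addf_div ?tofrac_eq0 // -!tofracM -tofracD.
rewrite !frac_mapE ?mulf_neq0 // !(rmorphD, rmorphM, rmorphN) /=.
by rewrite -[- (_ / _)]mulNr addf_div ?tofrac_eq0 ?f0 // mulNr.
Qed.
Fact frac_map_is_monoid_morphism : monoid_morphism frac_map.
Proof.
split=> [|x y]; first by rewrite -[1]divr1 -!tofrac1 frac_mapE ?oner_neq0 // !rmorph1.
have [a [b [b0 ->]]] := fracP x; have [c [d [d0 ->]]] := fracP y.
rewrite mulf_div -!tofracM !frac_mapE ?mulf_neq0 // !rmorphM /=.
by rewrite mulf_div.
Qed.
End Morphism.

Section Derivation.
Variables (d : {additive D -> D}).
Hypothesis dM : forall a b, d (a * b) = d a * b + a * d b.

Definition frac_der x :=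
  (d (fnum x) * fden x - fnum x * d (fden x))%:F / (fden x ^+ 2)%:F.

Lemma frac_derE a b : b != 0 ->
  frac_der (a%:F / b%:F) = (d a * b - a * d b)%:F / (b ^+ 2)%:F.
Proof.
move=> b0; rewrite /frac_der; set x := a%:F / b%:F.
have q0 := fden_neq0 x; set q := fden x in q0 *; set p := fnum x.
have /eqP : a%:F / b%:F == p%:F / q%:F by rewrite -frac_numden.
move/eqP; rewrite eq_frac // => /eqP E.
have /eqP := congr1 d E; rewrite !dM => /eqP dE.
apply/eqP; rewrite eq_frac ?expf_neq0 //; apply/eqP.
have -> : (d p * q - p * d q) * b ^+ 2 = (d p * b) * q * b - (p * b) * d q * b by ring.
have -> : d p * b = d a * q + a * d q - p * d b by rewrite dE addrK.
rewrite -E.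
have -> : (d a * q + a * d q - p * d b) * q * b - a * q * d q * b =
  d a * q ^+ 2 * b - (p * b) * d b * q by ring.
by rewrite -E; ring.
Qed.

Lemma frac_derD x y : frac_der (x + y) = frac_der x + frac_der y.
Proof.
have [a [b [b0 ->]]] := fracP x; have [c [e [e0 ->]]] := fracP y.
rewrite addf_div ?tofrac_eq0 // -!tofracM -tofracD !frac_derE ?mulf_neq0 //.
rewrite addf_div ?tofrac_eq0 ?expf_neq0 // -!tofracM -tofracD.
apply/eqP; rewrite eq_frac ?mulf_neq0 ?expf_neq0 // raddfD /= !dM.
by apply/eqP; ring.
Qed.
Lemma frac_derM x y : frac_der (x * y) = frac_der x * y + x * frac_der y.
Proof.
have [a [b [b0 ->]]] := fracP x; have [c [e [e0 ->]]] := fracP y.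
rewrite mulf_div -!tofracM !frac_derE ?mulf_neq0 // !mulf_div -!tofracM.
rewrite addf_div ?tofrac_eq0 ?mulf_neq0 ?expf_neq0 // -!tofracM -tofracD.
apply/eqP; rewrite eq_frac ?mulf_neq0 ?expf_neq0 // !dM.
by apply/eqP; ring.
Qed.
Lemma frac_der_tofrac a : frac_der a%:F = (d a)%:F.
Proof.
have d1 : d 1 = 0.
  by have /eqP := dM 1 1; rewrite !mulr1 mul1r -subr_eq subrr eq_sym => /eqP.
rewrite -[a%:F]divr1 -tofrac1 frac_derE ?oner_neq0 //.
by rewrite d1 mulr0 subr0 mulr1 expr1n divr1.
Qed.
End Derivation.
End FractionExtension.

Lemma mpoly_ring_ind (n : nat) (A : nzRingType) (P : {mpoly A[n]} -> Prop) :
  (forall c, P c%:MP) -> (forall i, P 'X_i) ->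
  (forall p q, P p -> P q -> P (p + q)) -> (forall p q, P p -> P q -> P (p * q)) ->
  forall p, P p.
Proof.
move=> PC PX PD PM p; rewrite [p]mpolyE.
apply: (big_ind P) => [|p1 p2|m _]; [by rewrite -mpolyC0|exact: PD|].
rewrite -mul_mpolyC; apply: (PM) => //; rewrite mpolyXE_id.
apply: (big_ind P) => [|p1 p2|i _]; [by rewrite -mpolyC1|exact: (PM)|].
elim: (m i) => [|k IH]; first by rewrite expr0 -mpolyC1.
by rewrite exprS; apply: PM.
Qed.

Section ReflectionGroup.
Variables (C : fieldType) (n : nat) (gT : finGroupType).
Local Notation V := 'cV[C]_n.
Local Notation CV := {mpoly C[n]}.
Variable W : mx_representation C [set: gT] n.

Definition fixed_space (w : gT) : {vspace V} :=
  lker (linfun (mulmx (W w - 1%:M) : V -> V)).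
Definition is_reflection (w : gT) : bool := (\dim (fixed_space w)).+1 == n.
Definition generated_by_reflections : Prop :=
  <<[set w | is_reflection w]>>%g = [set: gT].

Definition reflection_hyperplanes : seq {vspace V} :=
  undup [seq fixed_space w | w <- enum gT & is_reflection w].
Definition hyperplane : finType := seq_sub reflection_hyperplanes.
Definition hyp_translate (w : gT) (U : {vspace V}) : {vspace V} :=
  (linfun (mulmx (W w) : V -> V) @: U)%VS.
Definition pointwise_stab (H : hyperplane) : {set gT} :=
  [set w | (ssval H <= fixed_space w)%VS].
Definition nstab (H : hyperplane) : nat := #|pointwise_stab H|.

Record defining_forms : Type := DefiningForms {
  form :> hyperplane -> 'rV[C]_n;
  formP : forall (H : hyperplane) (v : V), (v \in ssval H) = (form H *m v == 0) }.

Definition multiplicity : Type := hyperplane -> nat -> int.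
Definition invariant_multiplicity (k : multiplicity) : Prop :=
  forall (w : gT) (H H' : hyperplane), ssval H' = hyp_translate w (ssval H) ->
  forall i, (i < nstab H)%N -> k H i = k H' i.

Definition linear_poly (a : 'rV[C]_n) : CV := \sum_(i < n) a 0 i *: 'X_i.

Definition poly_act (w : gT) : CV -> CV :=
  comp_mpoly [tuple \sum_(j < n) (W w^-1%g) i j *: 'X_j | i < n].
HB.instance Definition _ w := GRing.RMorphism.on (poly_act w).

Definition poly_der (xi : V) (p : CV) : CV := \sum_(i < n) xi i 0 *: p^`M(i).

Fact poly_der_is_zmod_morphism xi : zmod_morphism (poly_der xi).
Proof.
move=> p q; rewrite /poly_der -sumrB.
by apply: eq_bigr => i _; rewrite raddfB scalerBr.
Qed.
HB.instance Definition _ xi := GRing.isZmodMorphism.Build CV CV (poly_der xi)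
  (poly_der_is_zmod_morphism xi).

Lemma poly_derM xi p q : poly_der xi (p * q) = poly_der xi p * q + p * poly_der xi q.
Proof.
rewrite /poly_der mulr_suml mulr_sumr -big_split; apply: eq_bigr => i _ /=.
by rewrite mderivM scalerDr scalerAl scalerAr.
Qed.
Lemma poly_derC xi c : poly_der xi c%:MP = 0.
Proof. by rewrite /poly_der big1 // => i _; rewrite mderivC scaler0. Qed.
Lemma poly_derX xi i : poly_der xi 'X_i = (xi i 0)%:MP.
Proof.
rewrite /poly_der (bigD1 i) //= big1 => [|j ji].
  have -> : (U_(i) = 0 + U_(i) :> 'X_{1.. n})%MM by rewrite add0m.
  by rewrite addr0 mderivX mnmDE mnmE mnm1E eqxx addmK scale1r mpolyX0 -mul_mpolyC mulr1.
by rewrite mderivX mnm1E eq_sym (negPf ji) scale0r scaler0.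
Qed.

Lemma poly_actC w c : poly_act w c%:MP = c%:MP. Proof. exact: comp_mpolyC. Qed.
Lemma poly_actZ w c p : poly_act w (c *: p) = c *: poly_act w p.
Proof. exact: comp_mpolyZ. Qed.
Lemma poly_actX w i : poly_act w 'X_i = \sum_(j < n) (W w^-1%g) i j *: 'X_j.
Proof. by rewrite /poly_act comp_mpolyXU -tnth_nth tnth_mktuple. Qed.
Lemma poly_act_linear w a : poly_act w (linear_poly a) = linear_poly (a *m W w^-1%g).
Proof.
rewrite /linear_poly raddf_sum /=.
under eq_bigr => i _ do rewrite poly_actZ poly_actX scaler_sumr.
rewrite exchange_big; apply: eq_bigr => j _ /=; rewrite mxE scaler_suml.
by apply: eq_bigr => i _; rewrite scalerA.
Qed.

Lemma refl_repr1 : W 1%g = 1%:M. Proof. exact: repr_mx1. Qed.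
Lemma refl_reprM g h : W (g * h)%g = W g *m W h.
Proof. by rewrite repr_mxM ?inE. Qed.
Lemma refl_reprVK g : W g *m W g^-1%g = 1%:M.
Proof. by rewrite -refl_reprM mulgV refl_repr1. Qed.
Lemma refl_reprKV g : W g^-1%g *m W g = 1%:M.
Proof. by rewrite -refl_reprM mulVg refl_repr1. Qed.

Lemma XlinearE i : 'X_i = linear_poly (delta_mx 0 i) :> CV.
Proof.
rewrite /linear_poly (bigD1 i) //= big1 => [|j ji]; rewrite mxE eqxx.
  by rewrite eqxx scale1r addr0.
by rewrite (negPf ji) scale0r.
Qed.
Lemma poly_act1 p : poly_act 1%g p = p.
Proof.
elim/mpoly_ring_ind: p => [c|i|p q hp hq|p q hp hq].
- exact: poly_actC.
- by rewrite XlinearE poly_act_linear invg1 refl_repr1 mulmx1.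
- by rewrite rmorphD /= hp hq.
- by rewrite rmorphM /= hp hq.
Qed.
Lemma poly_actM g h p : poly_act (g * h)%g p = poly_act g (poly_act h p).
Proof.
elim/mpoly_ring_ind: p => [c|i|p q hp hq|p q hp hq].
- by rewrite !poly_actC.
- by rewrite XlinearE !poly_act_linear invMg refl_reprM mulmxA.
- by rewrite !rmorphD /= hp hq.
- by rewrite !rmorphM /= hp hq.
Qed.
Lemma poly_act_inj w : injective (poly_act w).
Proof.
by apply: (can_inj (g := poly_act w^-1%g)) => p; rewrite -poly_actM mulVg poly_act1.
Qed.
Lemma poly_der_act w xi p :
  poly_der (W w *m xi) (poly_act w p) = poly_act w (poly_der xi p).
Proof.
elim/mpoly_ring_ind: p => [c|i|p q hp hq|p q hp hq].
- by rewrite poly_actC !poly_derC rmorph0.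
- rewrite poly_derX poly_actC poly_actX raddf_sum /=.
  have E j : poly_der (W w *m xi) (W w^-1%g i j *: 'X_j) =
     ((W w^-1%g i j) * (W w *m xi) j 0)%:MP.
    by rewrite -mul_mpolyC poly_derM poly_derC mul0r add0r poly_derX -mpolyCM.
  under eq_bigr => j _ do rewrite E.
  rewrite -raddf_sum; congr (_%:MP).
  transitivity ((W w^-1%g *m (W w *m xi)) i 0); first by rewrite [RHS]mxE.
  by rewrite mulmxA refl_reprKV mul1mx.
- have aD u v : poly_act w (u + v) = poly_act w u + poly_act w v by exact: rmorphD.
  have dD eta u v : poly_der eta (u + v) = poly_der eta u + poly_der eta v.
    by exact: raddfD.
  by rewrite aD [in LHS]dD [in RHS]dD aD; apply: (congr2 _ hp hq).
- have aD u v : poly_act w (u + v) = poly_act w u + poly_act w v by exact: rmorphD.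
  have aM u v : poly_act w (u * v) = poly_act w u * poly_act w v by exact: rmorphM.
  rewrite aM [in LHS]poly_derM [in RHS]poly_derM aD [in RHS]aM [X in _ = _ + X]aM.
  by apply: congr2; [apply: (congr1 (fun z => z * _) hp)|apply: (congr1 (fun z => _ * z) hq)].
Qed.

Lemma memv_fixed w v : (v \in fixed_space w) = (W w *m v == v).
Proof. by rewrite memv_ker lfunE /= mulmxBl mul1mx subr_eq0. Qed.
Lemma memv_translate w U v : (v \in hyp_translate w U) = (W w^-1%g *m v \in U).
Proof.
apply/idP/idP => [/memv_imgP [u Uu ->]|hv].
  by rewrite lfunE /= mulmxA refl_reprKV mul1mx.
apply/memv_imgP; exists (W w^-1%g *m v) => //.
by rewrite lfunE /= mulmxA refl_reprVK mul1mx.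
Qed.
Lemma dim_translate w U : \dim (hyp_translate w U) = \dim U.
Proof.
apply: limg_dim_eq; apply/eqP; rewrite -subv0; apply/subvP => v.
rewrite memv_cap memv_ker lfunE /= memv0 => /andP [_ /eqP E].
by rewrite -[v]mul1mx -(refl_reprKV w) -mulmxA E mulmx0.
Qed.
Lemma translate_fixed w u :
  hyp_translate w (fixed_space u) = fixed_space (w * u * w^-1)%g.
Proof.
apply/vspaceP => v; rewrite memv_translate !memv_fixed !refl_reprM.
apply/eqP/eqP => E; first by rewrite -!mulmxA E mulmxA refl_reprVK mul1mx.
by rewrite -{2}E !mulmxA refl_reprKV mul1mx.
Qed.
Lemma hyperplanesP (U : {vspace V}) :
  reflect (exists2 u, is_reflection u & U = fixed_space u)
          (U \in reflection_hyperplanes).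
Proof.
rewrite mem_undup; apply: (iffP mapP) => [[u]|[u ru ->]].
  by rewrite mem_filter => /andP [ru _] ->; exists u.
by exists u; rewrite // mem_filter ru mem_enum.
Qed.
Lemma translate_hyperplane w (H : hyperplane) :
  hyp_translate w (ssval H) \in reflection_hyperplanes.
Proof.
have /hyperplanesP [u ru E] := ssvalP H; apply/hyperplanesP.
exists (w * u * w^-1)%g.
  2: exact: etrans (congr1 (hyp_translate w) E) (translate_fixed w u).
by rewrite /is_reflection -translate_fixed dim_translate.
Qed.
Definition hyp_act w (H : hyperplane) : hyperplane := SeqSub (translate_hyperplane w H).
Lemma hyp_act_inj w : injective (hyp_act w).
Proof.
move=> H H' /(congr1 val) /= E; apply/val_inj/vspaceP => v /=.
have := congr1 (fun U : {vspace V} => W w *m v \in U) E.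
by rewrite !memv_translate mulmxA refl_reprKV mul1mx.
Qed.

Variable alpha : defining_forms.

Lemma form_neq0 H : exists v : V, (alpha H *m v) 0 0 != 0.
Proof.
have /hyperplanesP [u /eqP ru E] := ssvalP H.
have : ssval H != fullv.
  by apply/eqP => F; move: ru; rewrite -E F dimvf /dim /= muln1 => /eqP; rewrite eqn_leq ltnn.
have [//|/existsNP [v hv] _] := pselect (forall v : V, v \in ssval H).
  by move=> F /eqP []; apply/vspaceP => v; rewrite F memvf.
exists v; apply/negP => /eqP z; apply: hv; rewrite (formP alpha).
by apply/eqP/matrixP => i j; rewrite !ord1 z mxE.
Qed.

Lemma form_translate w H : exists2 c : C, c != 0 &
  alpha H *m W w^-1%g = c *: alpha (hyp_act w H).
Proof.
set a := alpha H *m _; set b := alpha _.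
have ab (v : V) : (a *m v == 0) = (b *m v == 0).
  by rewrite -(formP alpha) /= memv_translate (formP alpha) mulmxA.
have [v bv] : exists v : V, (b *m v) 0 0 != 0 by exact: form_neq0.
have E11 (x : 'M[C]_1) : (x == 0) = (x 0 0 == 0).
  by apply/eqP/eqP => [->|e]; [rewrite mxE|apply/matrixP=> i j; rewrite !ord1 e mxE].
have SB (x y : 'M[C]_1) c : (x - c *: y) 0 0 = x 0 0 - c * y 0 0 by rewrite !mxE.
have LB (r : 'rV[C]_n) (x y : V) c : r *m (x - c *: y) = r *m x - c *: (r *m y).
  by rewrite mulmxBr scalemxAr.
have {}ab (u : V) : ((a *m u) 0 0 == 0) = ((b *m u) 0 0 == 0).
  by rewrite -(E11 (a *m u)) -(E11 (b *m u)).
move: ab bv; clearbody a b => ab bv.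
exists ((a *m v) 0 0 / (b *m v) 0 0).
  by rewrite mulf_neq0 ?invr_neq0 // ab.
have K (u : V) : (a *m u) 0 0 = (a *m v) 0 0 / (b *m v) 0 0 * (b *m u) 0 0.
  have := ab (u - ((b *m u) 0 0 / (b *m v) 0 0) *: v).
  rewrite (LB a) (LB b) !SB divfK // subrr eqxx subr_eq0; move=> /eqP ->.
  by rewrite mulrC mulrA mulrAC.
apply/rowP => j; have := K (delta_mx j 0).
by rewrite -!colE !mxE.
Qed.

Lemma linear_polyZ c a : linear_poly (c *: a) = c *: linear_poly a.
Proof. by rewrite /linear_poly scaler_sumr; apply: eq_bigr => i _; rewrite mxE scalerA. Qed.

Lemma linear_poly_form_neq0 H : linear_poly (alpha H) != 0.
Proof.
have [v hv] := form_neq0 H; apply: contraNneq hv => E.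
have : (linear_poly (alpha H)).@[fun i => v i 0] = 0 by rewrite E meval0.
rewrite /linear_poly raddf_sum mxE /= => {2}<-.
by apply/eqP/eq_bigr => i _; rewrite mevalZ mevalXU.
Qed.

Definition discr : CV := \prod_(H : hyperplane) linear_poly (alpha H).
Lemma discr_neq0 : discr != 0.
Proof. by apply/prodf_neq0 => H _; apply: linear_poly_form_neq0. Qed.
Lemma discrX_neq0 m : discr ^+ m != 0. Proof. by rewrite expf_neq0 ?discr_neq0. Qed.
Lemma act_discr w : exists2 c : C, c != 0 & poly_act w discr = c *: discr.
Proof.
have /choice [c hc] : forall H, exists c : C, c != 0 /\
  alpha H *m W w^-1%g = c *: alpha (hyp_act w H).
  by move=> H; have [c] := form_translate w H; exists c.
exists (\prod_H c H); first by apply/prodf_neq0 => H _; case: (hc H).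
rewrite /discr rmorph_prod /=.
transitivity (\prod_H (c H *: linear_poly (alpha (hyp_act w H)))).
  by apply: eq_bigr => H _; have [_ E] := hc H; rewrite poly_act_linear E linear_polyZ.
rewrite scaler_prod; congr (_ *: _).
by rewrite [RHS](reindex_inj (@hyp_act_inj w)).
Qed.

#[local] Opaque poly_act poly_der frac_map frac_der.
Local Notation K := {fraction CV}.

Definition regular_Vreg : pred K :=
  fun x => `[< exists (p : CV) (m : nat), x = p%:F / (discr ^+ m)%:F >].

Fact regular_Vreg_subring : subring_closed regular_Vreg.
Proof.
have frac_ring (p q : CV) r s : p%:F / (discr ^+ r)%:F - q%:F / (discr ^+ s)%:F =
    (p * discr ^+ s - q * discr ^+ r)%:F / (discr ^+ (r + s))%:F.
  by rewrite -mulNr addf_div ?tofrac_eq0 ?discrX_neq0 // mulNr -!tofracM -tofracB -exprD.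
split=> [|x y /asboolP [p [r ->]] /asboolP [q [s ->]]|
          x y /asboolP [p [r ->]] /asboolP [q [s ->]]]; apply/asboolP.
- by exists 1, 0%N; rewrite expr0 tofrac1 divr1.
- by exists (p * discr ^+ s - q * discr ^+ r), (r + s)%N.
- by exists (p * q), (r + s)%N; rewrite mulf_div -!tofracM -exprD.
Qed.

(* [C[V_reg]], the localization of [C[V]] at [discr] inside its fraction field. *)
Record Creg : Type := MkCreg { creg_val :> K; _ : regular_Vreg creg_val }.
HB.instance Definition _ := [isSub for creg_val].
HB.instance Definition _ := [Choice of Creg by <:].
HB.instance Definition _ :=
  GRing.SubChoice_isSubComNzRing.Build K regular_Vreg Creg regular_Vreg_subring.

Lemma cregP (f : Creg) : exists (p : CV) (m : nat), val f = p%:F / (discr ^+ m)%:F.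
Proof. by case: f => x /= /asboolP. Qed.

Lemma creg_valB (f g : Creg) : val (f - g) = val f - val g. Proof. by []. Qed.
Lemma creg_valD (f g : Creg) : val (f + g) = val f + val g. Proof. by []. Qed.
Lemma creg_valM (f g : Creg) : val (f * g) = val f * val g. Proof. by []. Qed.
Lemma creg_val1 : val (1 : Creg) = 1. Proof. by []. Qed.

Fact regular_poly (p : CV) : regular_Vreg p%:F.
Proof. by apply/asboolP; exists p, 0%N; rewrite expr0 tofrac1 divr1. Qed.
Definition creg_poly (p : CV) : Creg := MkCreg (regular_poly p).
Fact creg_poly_is_zmod_morphism : zmod_morphism creg_poly.
Proof. by move=> p q; apply/val_inj; rewrite /= raddfB. Qed.
Fact creg_poly_is_monoid_morphism : monoid_morphism creg_poly.
Proof. by split=> [|p q]; apply/val_inj; rewrite /= ?rmorph1 ?rmorphM. Qed.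
HB.instance Definition _ := GRing.isZmodMorphism.Build CV Creg creg_poly
  creg_poly_is_zmod_morphism.
HB.instance Definition _ := GRing.isMonoidMorphism.Build CV Creg creg_poly
  creg_poly_is_monoid_morphism.

Definition creg_const (c : C) : Creg := creg_poly c%:MP.
HB.instance Definition _ := GRing.RMorphism.copy creg_const (creg_poly \o @mpolyC n C).

Definition creg_scale (c : C) (f : Creg) : Creg := creg_const c * f.
Fact creg_scaleA a b f : creg_scale a (creg_scale b f) = creg_scale (a * b) f.
Proof. by rewrite /creg_scale rmorphM mulrA. Qed.
Fact creg_scale1 : left_id 1 creg_scale.
Proof. by move=> f; rewrite /creg_scale rmorph1 mul1r. Qed.
Fact creg_scaleDr : right_distributive creg_scale +%R.
Proof. by move=> a f g; apply: mulrDr. Qed.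
Fact creg_scaleDl f : {morph creg_scale^~ f : a b / a + b}.
Proof. by move=> a b; rewrite /creg_scale rmorphD mulrDl. Qed.
HB.instance Definition _ := GRing.Zmodule_isLmodule.Build C Creg
  creg_scaleA creg_scale1 creg_scaleDr creg_scaleDl.
Lemma creg_scaleE (c : C) (f : Creg) : c *: f = creg_const c * f. Proof. by []. Qed.

Fact regular_inv_form H : regular_Vreg (linear_poly (alpha H))%:F^-1.
Proof.
pose P := \prod_(H' : hyperplane | H' != H) linear_poly (alpha H').
have P0 : P != 0 by apply/prodf_neq0 => H' _; apply: linear_poly_form_neq0.
apply/asboolP; exists P, 1%N; rewrite expr1.
have -> : discr = linear_poly (alpha H) * P by rewrite /discr (bigD1 H).
by rewrite tofracM invfM mulrCA mulfV ?mulr1 // tofrac_eq0.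
Qed.
Definition inv_form H : Creg := MkCreg (regular_inv_form H).

Local Notation frac_act w := (frac_map (poly_act w)).
Local Notation frac_partial xi := (frac_der (poly_der xi)).

Fact regular_act w x : regular_Vreg x -> regular_Vreg (frac_act w x).
Proof.
move=> /asboolP [p [m ->]]; apply/asboolP.
have [c c0 E] := act_discr w.
exists (c ^- m *: poly_act w p), m.
rewrite frac_mapE ?discrX_neq0 //; last exact: poly_act_inj.
rewrite rmorphXn /= E exprZn.
have cm0 : c ^+ m != 0 by rewrite expf_neq0.
have cP0 : (c ^+ m)%:MP != 0 :> CV by rewrite mpolyC_eq0.
have D0 := discrX_neq0 m.
apply/eqP; rewrite eq_frac ?scaler_eq0 ?negb_or ?cm0 ?D0 //.
by rewrite -scalerAl -scalerAr scalerA mulVf // scale1r.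
Qed.
Definition creg_act w (f : Creg) : Creg :=
  MkCreg (@regular_act w (val f) (valP f)).

Fact regular_partial xi x : regular_Vreg x -> regular_Vreg (frac_partial xi x).
Proof.
move=> /asboolP [p [m ->]]; apply/asboolP.
rewrite frac_derE ?discrX_neq0 //; last exact: poly_derM.
by eexists; exists (m * 2)%N; rewrite exprM.
Qed.
Lemma creg_actE w f : val (creg_act w f) = frac_act w (val f). Proof. by []. Qed.
Definition creg_partial xi (f : Creg) : Creg :=
  MkCreg (@regular_partial xi (val f) (valP f)).

Lemma creg_partialE xi f : val (creg_partial xi f) = frac_partial xi (val f).
Proof. by []. Qed.

Fact creg_act_is_zmod_morphism w : zmod_morphism (creg_act w).
Proof.
move=> f g; apply/val_inj; rewrite creg_valB !creg_actE creg_valB.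
exact: (frac_map_is_zmod_morphism (@poly_act_inj w)).
Qed.
Fact creg_act_is_monoid_morphism w : monoid_morphism (creg_act w).
Proof.
have [f1 fM] := frac_map_is_monoid_morphism (@poly_act_inj w).
split=> [|f g]; apply/val_inj; first by rewrite creg_actE creg_val1.
by rewrite creg_valM !creg_actE creg_valM fM.
Qed.
HB.instance Definition _ w := GRing.isZmodMorphism.Build Creg Creg (creg_act w)
  (creg_act_is_zmod_morphism w).
HB.instance Definition _ w := GRing.isMonoidMorphism.Build Creg Creg (creg_act w)
  (creg_act_is_monoid_morphism w).

Lemma creg_act1 f : creg_act 1%g f = f.
Proof.
apply/val_inj => /=; have [p [m ->]] := cregP f.
by rewrite (frac_mapE (@poly_act_inj 1%g)) ?discrX_neq0 //= !poly_act1.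
Qed.
Lemma creg_actM g h f : creg_act (g * h)%g f = creg_act g (creg_act h f).
Proof.
apply/val_inj => /=; have [p [m ->]] := cregP f.
have D0 := discrX_neq0 m; have I := poly_act_inj.
have D1 : poly_act h (discr ^+ m) != 0.
  by apply: contraNneq D0 => E; apply/eqP/(I h); rewrite E rmorph0.
have E3 : frac_act (g * h)%g (p%:F / (discr ^+ m)%:F) =
    (poly_act g (poly_act h p))%:F / (poly_act g (poly_act h (discr ^+ m)))%:F.
  by rewrite -(poly_actM g h p) -(poly_actM g h (discr ^+ m)); exact: frac_mapE (I _) _ _ D0.
have E1 := frac_mapE (I h) p D0; have E2 := frac_mapE (I g) (poly_act h p) D1.
exact: etrans E3 (esym (etrans (congr1 (frac_act g) E1) E2)).
Qed.
Lemma creg_act_poly w p : creg_act w (creg_poly p) = creg_poly (poly_act w p).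
Proof.
apply/val_inj => /=; rewrite -[p%:F]divr1 -tofrac1 frac_mapE ?oner_neq0 //.
  by rewrite rmorph1 tofrac1 divr1.
exact: poly_act_inj.
Qed.
Lemma creg_act_const w c : creg_act w (creg_const c) = creg_const c.
Proof. by rewrite creg_act_poly poly_actC. Qed.

Lemma creg_partialD xi f g :
  creg_partial xi (f + g) = creg_partial xi f + creg_partial xi g.
Proof. by apply/val_inj; rewrite creg_valD !creg_partialE creg_valD (frac_derD (@poly_derM xi)). Qed.
Lemma creg_partialM xi f g :
  creg_partial xi (f * g) = creg_partial xi f * g + f * creg_partial xi g.
Proof.
apply/val_inj; rewrite creg_valD !creg_valM !creg_partialE creg_valM.
exact: (frac_derM (@poly_derM xi)).
Qed.
Lemma creg_partial_poly xi p :
  creg_partial xi (creg_poly p) = creg_poly (poly_der xi p).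
Proof. by apply/val_inj; apply: frac_der_tofrac; apply: poly_derM. Qed.
Lemma creg_partial_const xi c : creg_partial xi (creg_const c) = 0.
Proof. by rewrite creg_partial_poly poly_derC rmorph0. Qed.
Lemma creg_partial_act w xi f :
  creg_partial (W w *m xi) (creg_act w f) = creg_act w (creg_partial xi f).
Proof.
apply/val_inj => /=; have [p [m ->]] := cregP f.
have D0 := discrX_neq0 m; have I := @poly_act_inj w.
have D1 : poly_act w (discr ^+ m) != 0.
  by apply: contraNneq D0 => E; apply/eqP/I; rewrite E rmorph0.
have dM eta := @poly_derM eta.
rewrite (frac_derE (dM xi)) // (frac_mapE I) // (frac_mapE I) ?expf_neq0 ?discr_neq0 //.
rewrite (frac_derE (dM _)) // rmorphXn /=; congr (_%:F / _).
have aB u v : poly_act w (u - v) = poly_act w u - poly_act w v by exact: rmorphB.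
have aM u v : poly_act w (u * v) = poly_act w u * poly_act w v by exact: rmorphM.
by rewrite aB [in RHS]aM [X in _ = _ - X]aM (poly_der_act w xi p)
  (poly_der_act w xi (discr ^+ m)).
Qed.

(* [V_reg] is a smooth affine open subset of [V], so that the ring [D(V_reg)] is
   generated by the multiplications by regular_Vreg functions and the [d/dxi]. *)
Fact mul_op_linear (f : Creg) : linear (fun g : Creg => f * g).
Proof. by move=> c g h; rewrite mulrDr !creg_scaleE mulrCA. Qed.
Fact partial_op_linear xi : linear (creg_partial xi).
Proof.
move=> c g h; rewrite creg_partialD !creg_scaleE creg_partialM.
by rewrite creg_partial_const mul0r add0r.
Qed.
Fact act_op_linear w : linear (creg_act w).
Proof.
by move=> c g h; rewrite rmorphD !creg_scaleE rmorphM /= creg_act_const.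
Qed.
Definition mul_op f : lendo Creg := mk_lendo (mul_op_linear f).
Definition partial_op xi : lendo Creg := mk_lendo (partial_op_linear xi).
Definition act_op w : lendo Creg := mk_lendo (act_op_linear w).

Definition diffop_gen (d : lendo Creg) : Prop :=
  (exists f, d = mul_op f) \/ (exists xi, d = partial_op xi).
Definition diffop : Type := generated_subring diffop_gen.
HB.instance Definition _ := GRing.PzRing.on diffop.
Definition diffop_fun (f : Creg) : diffop :=
  gs_gen (or_introl (ex_intro _ f erefl) : diffop_gen (mul_op f)).
Definition diffop_partial (xi : V) : diffop :=
  gs_gen (or_intror (ex_intro _ xi erefl) : diffop_gen (partial_op xi)).

Definition op_conj w (d : lendo Creg) : lendo Creg := act_op w * d * act_op w^-1%g.

Lemma act_opK w : act_op w^-1%g * act_op w = 1.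
Proof.
by apply: lendoP => f; rewrite lendoME !mk_lendoE -creg_actM mulVg creg_act1.
Qed.
Lemma op_conjE w d f : op_conj w d f = creg_act w (d (creg_act w^-1%g f)).
Proof. by []. Qed.
Lemma op_conj_gen w d : diffop_gen d -> diffop_gen (op_conj w d).
Proof.
case=> [[f ->]|[xi ->]]; [left; exists (creg_act w f)|right; exists (W w *m xi)];
  apply: lendoP => g; rewrite op_conjE !mk_lendoE.
  by rewrite rmorphM /= -creg_actM mulgV creg_act1.
by rewrite -creg_partial_act -creg_actM mulgV creg_act1.
Qed.
Lemma op_conj1 w : op_conj w 1 = 1.
Proof. by rewrite /op_conj mulr1 -{1}[w]invgK act_opK. Qed.
Lemma op_conjB w d e : op_conj w (d - e) = op_conj w d - op_conj w e.
Proof. by rewrite /op_conj mulrBr mulrBl. Qed.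
Lemma op_conjM w d e : op_conj w (d * e) = op_conj w d * op_conj w e.
Proof. by rewrite /op_conj !mulrA -[_ * act_op w^-1%g * _]mulrA act_opK mulr1. Qed.
Fact op_conj_span w d :
  in_subring_span diffop_gen d -> in_subring_span diffop_gen (op_conj w d).
Proof.
move=> /asboolP h; apply/asboolP; elim: h => [x gx||x y _ hx _ hy|x y _ hx _ hy].
- by apply: Span_gen; apply: op_conj_gen.
- by rewrite op_conj1; apply: Span_one.
- by rewrite op_conjB; apply: Span_sub.
- by rewrite op_conjM; apply: Span_mul.
Qed.
Definition diffop_act w (d : diffop) : diffop :=
  GeneratedSubring (@op_conj_span w (val d) (valP d)).
Lemma diffop_actE w d f :
  gs_val (diffop_act w d) f = creg_act w (gs_val d (creg_act w^-1%g f)).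
Proof. by []. Qed.
Fact diffop_act_is_zmod_morphism w : zmod_morphism (diffop_act w).
Proof. by move=> d e; apply/val_inj; exact: (op_conjB w (gs_val d) (gs_val e)). Qed.
Fact diffop_act_is_monoid_morphism w : monoid_morphism (diffop_act w).
Proof. by split=> [|d e]; apply/val_inj; [exact: (op_conj1 w)|exact: (op_conjM w (gs_val d) (gs_val e))]. Qed.
HB.instance Definition _ w := GRing.isZmodMorphism.Build diffop diffop (diffop_act w)
  (diffop_act_is_zmod_morphism w).
HB.instance Definition _ w := GRing.isMonoidMorphism.Build diffop diffop (diffop_act w)
  (diffop_act_is_monoid_morphism w).

Fact diffop_act1 d : diffop_act 1%g d = d.
Proof.
apply/val_inj; apply: lendoP => f.
by transitivity (op_conj 1%g (gs_val d) f); rewrite // op_conjE invg1 !creg_act1.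
Qed.
Fact diffop_actM g h d : diffop_act (g * h)%g d = diffop_act g (diffop_act h d).
Proof.
apply/val_inj; apply: lendoP => f.
transitivity (op_conj (g * h)%g (gs_val d) f); first by [].
transitivity (op_conj g (op_conj h (gs_val d)) f); last by [].
by rewrite !op_conjE creg_actM invMg creg_actM.
Qed.
Definition diffop_action : ring_action diffop gT :=
  @RingAction diffop gT (fun w => diffop_act w) diffop_act1 diffop_actM.

Definition DW : Type := crossed diffop_action.
HB.instance Definition _ := GRing.PzRing.on DW.
Definition DW_fun (f : Creg) : DW := crossed_coef diffop_action (diffop_fun f).
Definition DW_partial (xi : V) : DW := crossed_coef diffop_action (diffop_partial xi).
Definition DW_grp (w : gT) : DW := crossed_grp diffop_action w.

(* Elements of [C W] are given by their coefficient functions. *)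
Definition DW_grpalg (c : gT -> C) : DW :=
  \sum_(w : gT) DW_fun (creg_const (c w)) * DW_grp w.

Definition idem_coef (H : hyperplane) (i : nat) (w : gT) : C :=
  if w \in pointwise_stab H then (nstab H)%:R^-1 * \det (W w) ^- i else 0.

(* The function [alpha_H(xi) / alpha_H]. *)
Definition dlog_form (H : hyperplane) (xi : V) : Creg :=
  creg_const ((alpha H *m xi) 0 0) * inv_form H.

(* [C[V_reg] (x) tau] as an [H_k]-module. *)
Definition reg_module (_ : multiplicity) (m : nat)
  (_ : mx_representation C [set: gT] m) : Type := 'cV[Creg]_m.
HB.instance Definition _ k m tau := GRing.Zmodule.on (@reg_module k m tau).

Section Cherednik.
Variable k : multiplicity.

Definition dunkl (xi : V) : DW :=
  DW_partial xi -
  \sum_(H : hyperplane) DW_fun (dlog_form H xi) *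
    \sum_(i < nstab H) DW_grpalg (idem_coef H i) *~ ((nstab H)%:Z * k H i).

Definition Hk_gen (x : DW) : Prop :=
  [\/ exists p : CV, x = DW_fun (creg_poly p),
      exists w : gT, x = DW_grp w |
      exists xi : V, x = dunkl xi].
Definition Hk : Type := generated_subring Hk_gen.
HB.instance Definition _ := GRing.PzRing.on Hk.
Definition Hk_poly (p : CV) : Hk :=
  gs_gen (Or31 _ _ (ex_intro _ p erefl) : Hk_gen (DW_fun (creg_poly p))).
Definition Hk_grp (w : gT) : Hk :=
  gs_gen (Or32 _ _ (ex_intro _ w erefl) : Hk_gen (DW_grp w)).
Definition Hk_dunkl (xi : V) : Hk :=
  gs_gen (Or33 _ _ (ex_intro _ xi erefl) : Hk_gen (dunkl xi)).

Section Representation.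
Variables (m : nat) (tau : mx_representation C [set: gT] m).

(* ['rV[Hk]_m] is [H_k (x)_C tau], the [j]-th unit vector being [1 (x) u_j].  The
   standard module is its quotient by the relations [h a (x) u = h (x) a u] for
   [a] in the generating set [W] and [V] of [C[V*] * W], where [xi u = 0] for [xi]
   in [V]. *)
Definition pure_tensor (h : Hk) (u : 'cV[C]_m) : 'rV[Hk]_m :=
  \row_j (h * Hk_poly (u j 0)%:MP).
Definition standard_rel (x : 'rV[Hk]_m) : Prop :=
  (exists (w : gT) (u : 'cV[C]_m),
     x = pure_tensor (Hk_grp w) u - pure_tensor 1 (tau w *m u)) \/
  (exists (xi : V) (u : 'cV[C]_m), x = pure_tensor (Hk_dunkl xi) u).
Definition standard_module : Type := quotient_module standard_rel.
HB.instance Definition _ := GRing.Lmodule.on standard_module.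

(* ['cV[Creg]_m] is [C[V_reg] (x) tau], and [twisted_act w] is the diagonal action
   of [w] on it, i.e. [phi |-> w (phi (w^-1 .))]. *)
Definition twisted_act (w : gT) (phi : 'cV[Creg]_m) : 'cV[Creg]_m :=
  map_mx creg_const (tau w) *m map_mx (creg_act w) phi.
Definition DW_act (x : DW) (phi : 'cV[Creg]_m) : 'cV[Creg]_m :=
  \sum_(w : gT) map_mx (gs_val (x w)) (twisted_act w phi).

Lemma twisted_act1 phi : twisted_act 1%g phi = phi.
Proof.
rewrite /twisted_act repr_mx1 map_mx1 mul1mx.
by apply/matrixP => i j; rewrite mxE creg_act1.
Qed.
Lemma twisted_actM g h phi :
  twisted_act (g * h)%g phi = twisted_act g (twisted_act h phi).
Proof.
rewrite /twisted_act repr_mxM ?inE // map_mxM -mulmxA; congr (_ *m _).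
rewrite map_mxM; congr (_ *m _); apply/matrixP => i j; rewrite !mxE.
  by rewrite /= creg_act_const.
by rewrite /= creg_actM.
Qed.
Lemma twisted_actD w : {morph twisted_act w : phi psi / phi + psi}.
Proof. by move=> phi psi; rewrite /twisted_act map_mxD mulmxDr. Qed.
Lemma twisted_act_sum w (I : Type) (r : seq I) P (F : I -> 'cV[Creg]_m) :
  twisted_act w (\sum_(i <- r | P i) F i) = \sum_(i <- r | P i) twisted_act w (F i).
Proof.
apply: big_morph; first exact: twisted_actD.
by rewrite /twisted_act map_mx0 mulmx0.
Qed.
Lemma map_op_sum (d : lendo Creg) (I : Type) (r : seq I) P (F : I -> 'cV[Creg]_m) :
  map_mx d (\sum_(i <- r | P i) F i) = \sum_(i <- r | P i) map_mx d (F i).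
Proof.
apply: (big_morph (fun A => map_mx d A)) => [A B|].
  by apply/matrixP => i j; rewrite !mxE linearD.
by apply/matrixP => i j; rewrite !mxE linear0.
Qed.
Lemma map_sum_op (phi : 'cV[Creg]_m) (I : Type) (r : seq I) P (F : I -> diffop) :
  map_mx (gs_val (\sum_(i <- r | P i) F i)) phi =
  \sum_(i <- r | P i) map_mx (gs_val (F i)) phi.
Proof.
apply: (big_morph (fun d : diffop => map_mx (gs_val d) phi)) => [d e|].
  by apply/matrixP => i j; rewrite !mxE.
by apply/matrixP => i j; rewrite !mxE.
Qed.
Lemma twisted_act_op w (d : diffop) phi :
  twisted_act w (map_mx (gs_val d) phi) =
  map_mx (gs_val (diffop_act w d)) (twisted_act w phi).
Proof.
apply/matrixP => i j; rewrite !mxE diffop_actE raddf_sum linear_sum raddf_sum.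
apply: eq_bigr => l _ /=; rewrite !mxE !rmorphM /= !creg_act_const -creg_actM mulVg.
by rewrite creg_act1 -!creg_scaleE linearZ /= creg_scaleE rmorphM /= creg_act_const.
Qed.

Local Notation RM := (reg_module k tau).
Definition reg_scale (h : Hk) (phi : RM) : RM := DW_act (gs_val h) phi.

Lemma DW_act_coef (d : diffop) phi :
  DW_act (crossed_coef diffop_action d) phi = map_mx (gs_val d) phi.
Proof.
rewrite /DW_act (bigD1 1%g) //= big1 => [|w /negPf w1].
  by rewrite addr0 ffunE eqxx twisted_act1.
by rewrite ffunE w1; apply/matrixP => i j; rewrite !mxE.
Qed.
Lemma DW_act_fun f phi : DW_act (DW_fun f) phi = f *: phi.
Proof. by rewrite DW_act_coef; apply/matrixP => i j; rewrite !mxE. Qed.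
Lemma DW_act_partial xi phi : DW_act (DW_partial xi) phi = map_mx (creg_partial xi) phi.
Proof. by rewrite DW_act_coef; apply/matrixP => i j; rewrite !mxE. Qed.
Lemma DW_act_grp w phi : DW_act (DW_grp w) phi = twisted_act w phi.
Proof.
rewrite /DW_act (bigD1 w) //= big1 => [|u /negPf uw].
  by rewrite addr0 ffunE eqxx; apply/matrixP => i j; rewrite mxE.
by rewrite ffunE uw; apply/matrixP => i j; rewrite !mxE.
Qed.

Fact DW_actA (x y : DW) phi : DW_act x (DW_act y phi) = DW_act (x * y) phi.
Proof.
rewrite /DW_act.
under [RHS]eq_bigr => g _ do rewrite ffunE map_sum_op.
rewrite [RHS]exchange_big; apply: eq_bigr => h _ /=.
rewrite twisted_act_sum map_op_sum [RHS](reindex_inj (mulgI h)) /=.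
apply: eq_bigr => u _; rewrite twisted_act_op -twisted_actM mulKg.
by apply/matrixP => i j; rewrite !mxE.
Qed.
Fact reg_scaleA a b phi : reg_scale a (reg_scale b phi) = reg_scale (a * b) phi.
Proof. exact: DW_actA. Qed.
Fact reg_scale1 : left_id 1 reg_scale.
Proof.
move=> phi; rewrite /reg_scale /DW_act (bigD1 1%g) //= big1 => [|w /negPf w1].
  by rewrite addr0 ffunE eqxx twisted_act1; apply/matrixP => i j; rewrite mxE.
by rewrite ffunE w1; apply/matrixP => i j; rewrite !mxE.
Qed.
Fact reg_scaleDr : right_distributive reg_scale +%R.
Proof.
move=> a phi psi; rewrite /reg_scale /DW_act -big_split; apply: eq_bigr => w _ /=.
by rewrite twisted_actD; apply/matrixP => i j; rewrite !mxE linearD.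
Qed.
Fact reg_scaleDl phi : {morph reg_scale^~ phi : a b / a + b}.
Proof.
move=> a b; rewrite /reg_scale /DW_act -big_split; apply: eq_bigr => w _ /=.
by rewrite ffunE; apply/matrixP => i j; rewrite !mxE.
Qed.
HB.instance Definition _ := GRing.Zmodule_isLmodule.Build Hk RM
  reg_scaleA reg_scale1 reg_scaleDr reg_scaleDl.

Definition rep_idem (H : hyperplane) (i : nat) : 'M[C]_m :=
  \sum_(w : gT) idem_coef H i w *: tau w.
Definition idem_act (H : hyperplane) (i : nat) (phi : 'cV[Creg]_m) : 'cV[Creg]_m :=
  map_mx creg_const (rep_idem H i) *m phi.

(* Regularity at the generic point of [H]: some denominator does not vanish
   identically on [H]. *)
Definition regular_along (H : hyperplane) (x : K) : Prop :=
  exists (p q : CV) (v : V),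
    [/\ v \in ssval H, q.@[fun i => v i 0] != 0 & x = p%:F / q%:F].

Definition quasi_invariant (phi : RM) : Prop :=
  forall (H : hyperplane) (i : nat), (i < nstab H)%N -> forall j : 'I_m,
  regular_along H ((linear_poly (alpha H))%:F ^ (- ((nstab H)%:Z * k H i)) *
                   creg_val (idem_act H i phi j 0)).

Definition kz_solution (y : 'cV[Creg]_m) : Prop :=
  forall xi : V,
    map_mx (creg_partial xi) y +
    \sum_(H : hyperplane) dlog_form H xi *:
      \sum_(i < nstab H) idem_act H i y *~ ((nstab H)%:Z * k H i) = 0.
End Representation.

(* [is_kz sigma tau] states [kz_k(sigma) = tau]: the global solutions of the KZ
   system for [sigma] form a space of dimension [dim sigma] which, under
   [twisted_act sigma], is a representation isomorphic to [tau]; the isomorphism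
   sends [u] to [Y *m u], so that the columns of [Y] form a basis of solutions. *)
Definition is_kz (m' : nat) (sigma : mx_representation C [set: gT] m')
    (m : nat) (tau : mx_representation C [set: gT] m) : Prop :=
  m = m' /\
  exists Y : 'M[Creg]_(m', m),
    let sol (u : 'cV[C]_m) : 'cV[Creg]_m' := Y *m map_mx creg_const u in
    [/\ injective sol,
        forall y, kz_solution sigma y <-> exists u, y = sol u &
        forall (w : gT) (u : 'cV[C]_m), sol (tau w *m u) = twisted_act sigma w (sol u)].
End Cherednik.
End ReflectionGroup.

(* Main.v *)
From HB Require Import structures.
Require Import Defs.
From mathcomp Require Import all_boot all_order all_fingroup all_algebra.
From mathcomp Require Import all_solvable all_field all_character.
From mathcomp Require Import boolp reals.
From mathcomp Require Import complex mpoly ring.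

Set Implicit Arguments.
Unset Strict Implicit.
Unset Printing Implicit Defensive.

Import GRing.Theory.
Local Open Scope ring_scope.

(* Let Y be the fundamental matrix of the KZ system of tau', whose columns are
   permuted by W according to tau.  Since [d_xi Y = - A_xi Y], the determinant of
   Y is a nonzero constant times a product of powers of the alpha_H (Jacobi's
   formula, the residues of A having integral trace), so X = Y^-1 has entries in
   C[V_reg].  The equation and the W-equivariance of Y say exactly that the
   vectors X u, for u in tau', are killed by the Dunkl operators and transform
   under W by tau'.  Hence [p (x) u |-> p X u] defines M_k(tau') -> C[V_reg] (x) tau;
   it is injective because the p (x) u already span M_k(tau') (the commutators
   [T_xi, p] lie in C[V] * W) and X is invertible.

   The image is X C[V]^m, and it remains to see that phi is quasi-invariant iff
   Y phi is polynomial.  Both conditions are local at the generic points of the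
   hyperplanes.  Near H put G = sum_i alpha_H^(n_H k_{H,i}) e_{H,i}, so that phi is
   quasi-invariant along H iff G^-1 phi is regular along H.  Then Y G and its
   inverse are both regular along H.  Indeed let N > 0 be the order of the pole of
   Y G.  In its leading coefficient, the component between the e_{H,i}-part and the
   e_{H,j}-part can be nonzero only if N = n_H (k_{H,i} - k_{H,j}), by the equation,
   and only if j - i = N modulo n_H, by W_H-equivariance.  As N > 0, the first
   condition gives i <> j; as it also makes n_H divide N, the second gives i = j. *)

(** * Polynomial functions *)

Section PolynomialFunctions.
Variables (C : fieldType) (n : nat).
Hypothesis char0 : [pchar C] =i pred0.
Local Notation V := 'cV[C]_n.
Local Notation CV := {mpoly C[n]}.

Definition eval_at (v : V) (p : CV) : C := p.@[fun i => v i 0].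
HB.instance Definition _ v :=
  GRing.RMorphism.copy (eval_at v) (meval (fun i => v i 0)).

Lemma eval_atC v c : eval_at v c%:MP = c. Proof. exact: mevalC. Qed.

Lemma natr_char0 k : (k%:R == 0 :> C) = (k == 0%N).
Proof. exact: ((pcharf0P C).1 char0). Qed.

(** In characteristic zero the integers below [size p] are distinct in [C]; this is one root more
    than a nonzero [p] can have. *)
Lemma poly_vanishes (p : {poly C}) : (forall t, p.[t] = 0) -> p = 0.
Proof.
move=> h; apply/eqP; apply: contraT => p0.
have := @max_poly_roots _ p [seq i%:R | i <- iota 0 (size p)] p0.
rewrite size_map size_iota ltnn; apply.
  by apply/allP => x _; apply/rootP.
rewrite map_inj_in_uniq ?iota_uniq // => i j _ _.
wlog ij : i j / (i <= j)%N.
  by move=> H E; case/orP: (leq_total i j) => L; [apply: H|apply/esym/H].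
move=> /esym /eqP; rewrite -subr_eq0 -natrB // natr_char0.
by rewrite subn_eq0 => ji; apply/eqP; rewrite eqn_leq ij.
Qed.

(** Restriction to the parametrized line [t |-> v + t u]. As a ring morphism to univariate
    polynomials it reduces questions in several variables to roots and coefficients. *)
Definition on_line (v u : V) (p : CV) : {poly C} :=
  mmap polyC (fun i => (v i 0)%:P + u i 0 *: 'X) p.
HB.instance Definition _ v u := GRing.RMorphism.copy (on_line v u)
  (mmap (polyC : {rmorphism C -> {poly C}}) (fun i => (v i 0)%:P + u i 0 *: 'X)).

Lemma on_lineE v u p t : (on_line v u p).[t] = eval_at (v + t *: u) p.
Proof.
elim/mpoly_ring_ind: p => [c|i|p q hp hq|p q hp hq].
- by rewrite /on_line mmapC hornerC eval_atC.
- rewrite /on_line /eval_at mmapX mmap1U mevalXU !mxE.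
  by rewrite hornerD hornerC hornerZ hornerX mulrC.
- by rewrite !rmorphD /= hornerD hp hq.
- by rewrite !rmorphM /= hornerM hp hq.
Qed.

Lemma on_line0 v u p : (on_line v u p).[0] = eval_at v p.
Proof. by rewrite on_lineE scale0r addr0. Qed.

(** The chain rule. Both sides are derivations along the morphism [on_line v u], so comparing them
    on constants and variables suffices. *)
Lemma on_line_der v u p : (on_line v u p)^`() = on_line v u (poly_der u p).
Proof.
elim/mpoly_ring_ind: p => [c|i|p q hp hq|p q hp hq].
- by rewrite poly_derC rmorph0 /on_line mmapC derivC.
- rewrite poly_derX /on_line mmapC mmapX mmap1U derivD derivC add0r derivZ derivX.
  by rewrite alg_polyC.
- by rewrite rmorphD derivD hp hq -rmorphD -raddfD.
- rewrite rmorphM derivM hp hq poly_derM.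
  by rewrite [RHS]rmorphD; congr (_ + _); rewrite rmorphM.
Qed.

(* By induction on the degree of the monomial [m]: if [p] vanishes everywhere, so do its
   partial derivatives. *)
Lemma mpoly_vanishes (p : CV) : (forall v, eval_at v p = 0) -> p = 0.
Proof.
move=> h; apply/mpolyP => m; rewrite mcoeff0.
have [k] : exists k, mdeg m = k by exists (mdeg m).
elim: k m p h => [|k IH] m p h.
  move/eqP; rewrite mdeg_eq0 => /eqP ->.
  (* The constant coefficient is the value at the origin. *)
  rewrite -(h 0) /eval_at mevalE.
  have E (q : 'X_{1..n}) : \prod_i (0 : V) i 0 ^+ q i = (q == 0%MM)%:R.
    have [->|q0] := eqVneq; first by rewrite big1 // => i _; rewrite mnm0E.
    have [i qi] : exists i, q i != 0%N.
      apply/existsP; apply: contraNT q0; rewrite negb_exists => /forallP q0.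
      by apply/eqP/mnmP => i; rewrite mnm0E; apply/eqP; rewrite -[_ == _]negbK.
    by rewrite (bigD1 i) //= mxE expr0n (negPf qi) mul0r.
  under eq_bigr => q _ do rewrite E.
  have [s|s] := boolP (0%MM \in msupp p).
    rewrite (bigD1_seq 0%MM) ?msupp_uniq //= eqxx mulr1 big1 ?addr0 // => q /negPf ->.
    by rewrite mulr0.
  rewrite (memN_msupp_eq0 s) big_seq big1 // => q qs; case: eqP => [E0|_].
    by rewrite -E0 qs in s.
  by rewrite mulr0.
move=> mk; have [i mi] : exists i, m i != 0%N.
  apply/existsP; apply: contraT; rewrite negb_exists => /forallP m0.
  have E0 : m = 0%MM by apply/mnmP => i; rewrite mnm0E; apply/eqP; rewrite -[_ == _]negbK.
  by rewrite E0 mdeg0 in mk.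
have U : (U_(i) <= m)%MM.
  by apply/mnm_lepP => j; rewrite mnm1E; case: eqP => // <-; rewrite lt0n.
have Em : m = (m - U_(i) + U_(i))%MM by rewrite submK.
have := IH (m - U_(i))%MM p^`M(i).
rewrite mcoeff_mderiv -Em => H.
have /eqP : p@_m *+ ((m - U_(i))%MM i).+1 = 0.
  apply: H => [v|]; last first.
    by move: mk; rewrite {1}Em mdegD mdeg1 addn1 => -[].
  have -> : p^`M(i) = poly_der (delta_mx i 0) p.
    rewrite /poly_der (bigD1 i) //= mxE !eqxx scale1r big1 ?addr0 // => j /negPf ji.
    by rewrite mxE ji scale0r.
  rewrite -(on_line0 _ (delta_mx i 0)) -on_line_der.
  suff -> : on_line v (delta_mx i 0) p = 0 by rewrite deriv0 horner0.
  by apply: poly_vanishes => t; rewrite on_lineE h.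
by rewrite -mulr_natr mulf_eq0 => /orP [/eqP //|]; rewrite natr_char0.
Qed.

Lemma nonvanishing (p : CV) : p != 0 -> exists v, eval_at v p != 0.
Proof.
move=> p0; have [//|/existsNP [v /eqP hv]] := pselect (forall v, eval_at v p = 0).
  by move/mpoly_vanishes => E; rewrite E eqxx in p0.
by exists v.
Qed.

(** Irreducibility of a linear subspace: on the line joining the two points, which stays in [U],
    both restrictions are nonzero polynomials, so their product has a non-root. *)
Lemma nonvanishingM (U : {vspace V}) p q (v1 v2 : V) : v1 \in U -> v2 \in U ->
  eval_at v1 p != 0 -> eval_at v2 q != 0 ->
  exists2 v : V, v \in U & eval_at v (p * q) != 0.
Proof.
move=> U1 U2 h1 h2; pose l := on_line v1 (v2 - v1).
have lp : l p != 0.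
  by apply: contraNneq h1 => E; rewrite -(on_line0 _ (v2 - v1)) -/(l p) E horner0.
have lq : l q != 0.
  apply: contraNneq h2 => E; have := on_lineE v1 (v2 - v1) q 1.
  by rewrite -/(l q) E horner0 scale1r subrKC => <-.
have : l p * l q != 0 by rewrite mulf_neq0.
have [h|/existsNP [t /eqP ht] _] := pselect (forall t, (l p * l q).[t] = 0).
  by rewrite (poly_vanishes h) eqxx.
exists (v1 + t *: (v2 - v1)); first by rewrite rpredD ?rpredZ ?rpredB.
by move: ht; rewrite hornerM !on_lineE rmorphM.
Qed.

Lemma eval_linear (v : V) a : eval_at v (linear_poly a) = (a *m v) 0 0.
Proof.
rewrite /linear_poly raddf_sum mxE; apply: eq_bigr => i _ /=.
by rewrite /eval_at mevalZ mevalXU.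
Qed.

Lemma poly_der_linear (xi : V) a : poly_der xi (linear_poly a) = ((a *m xi) 0 0)%:MP.
Proof.
rewrite /linear_poly raddf_sum mxE raddf_sum; apply: eq_bigr => i _ /=.
by rewrite -mul_mpolyC poly_derM poly_derC mul0r add0r poly_derX -mpolyCM.
Qed.

(* Compare [p] with its pullback under the projection [v |-> v - a(v) xi]. *)
Lemma linear_factor (a : 'rV[C]_n) p : a != 0 ->
  (forall v : V, a *m v = 0 -> eval_at v p = 0) -> exists q, p = linear_poly a * q.
Proof.
move=> a0 h.
have [xi axi] : exists xi : V, a *m xi = 1%:M.
  have /existsP [i ai] : [exists i, a 0 i != 0].
    apply: contraNT a0; rewrite negb_exists => /forallP H; apply/eqP/rowP => i.
    by rewrite mxE; apply/eqP; rewrite -[_ == _]negbK H.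
  exists ((a 0 i)^-1 *: delta_mx i 0); rewrite -scalemxAr -colE.
  by apply/matrixP => x y; rewrite !ord1 !mxE eqxx mulVf.
pose l := linear_poly a.
pose pi := [tuple 'X_i - xi i 0 *: l | i < n].
have Epi v q : eval_at v (q \mPo pi) = eval_at (v - (a *m v) 0 0 *: xi) q.
  rewrite /eval_at comp_mpoly_meval; apply: meval_eq => i.
  by rewrite tnth_mktuple mevalB mevalXU mevalZ -/(eval_at v l) eval_linear !mxE mulrC.
have p0 : p \mPo pi = 0.
  apply: mpoly_vanishes => v; rewrite Epi; apply: h.
  rewrite mulmxBr -scalemxAr axi; apply/matrixP => i j; rewrite !ord1 !mxE eqxx mulr1.
  by rewrite subrr.
(* The substitution [pi] is the identity modulo [l] on the variables, hence on every polynomial. *)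
suff [q E] : exists q, p = p \mPo pi + l * q by exists q; rewrite {1}E p0 add0r.
elim/mpoly_ring_ind: p {h p0} => [c|i|p q [p1 hp] [q1 hq]|p q [p1 hp] [q1 hq]].
- by exists 0; rewrite comp_mpolyC mulr0 addr0.
- exists (xi i 0)%:MP; rewrite comp_mpolyXU -tnth_nth tnth_mktuple.
  by rewrite [l * _]mulrC mul_mpolyC subrK.
- exists (p1 + q1); rewrite comp_mpolyD mulrDr {1}hp {1}hq; ring.
- exists (p1 * q + (p \mPo pi) * q1); rewrite rmorphM /= {1}hp {1 3}hq; ring.
Qed.
End PolynomialFunctions.

(** * Regularity along a hyperplane *)

(** Compare coefficients of [t^k]: once the coefficients of [g] up to degree [k] vanish, only
    [d_0 (k+1) g_(k+1)] is left, and both scalars are nonzero. *)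
Lemma linear_ode_unique (C : fieldType) (m : nat) (d : {poly C})
    (b : 'M[{poly C}]_m) (g : 'cV[{poly C}]_m) : [pchar C] =i pred0 ->
  (forall i, d * (g i 0)^`() = (b *m g) i 0) -> d`_0 != 0 ->
  (forall i, (g i 0)`_0 = 0) -> g = 0.
Proof.
move=> char0 ode d0 g0; apply/matrixP => i j; rewrite ord1 [RHS]mxE {j}.
apply/polyP => k; rewrite coef0; elim/ltn_ind: k i => -[|k] IH i; first exact: g0.
have := congr1 (fun q : {poly C} => q`_k) (ode i).
rewrite mxE coef_sum [RHS]big1 => [|j _]; last first.
  by rewrite coefM big1 // => l _; rewrite IH ?mulr0 // ltnS leq_subr.
rewrite coefM big_ord_recl /= subn0 big1 => [|l _]; last first.
  by rewrite coef_deriv IH ?mul0rn ?mulr0 // /bump /= add1n ltnS -subSn // subSS leq_subr.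
rewrite addr0 coef_deriv -mulr_natr => /eqP; rewrite !mulf_eq0 (negPf d0) /=.
by rewrite natr_char0 // orbF => /eqP.
Qed.

Section LocalRegularity.
Variables (C : fieldType) (n : nat) (gT : finGroupType).
Hypothesis char0 : [pchar C] =i pred0.
Variables (W : mx_representation C [set: gT] n) (alpha : defining_forms W).
Local Notation V := 'cV[C]_n.
Local Notation CV := {mpoly C[n]}.
Local Notation Creg := (Creg alpha).
Local Notation cp := (creg_poly alpha).
Implicit Types (H : hyperplane W) (f g : Creg) (p q : CV).

Definition lform H : CV := linear_poly (alpha H).
Definition creg_form H : Creg := cp (lform H).

Lemma creg_poly_inj : injective cp.
Proof. by move=> p q /(congr1 val) /= /eqP; rewrite tofrac_eq => /eqP. Qed.

Lemma creg_polyI q f g : q != 0 -> cp q * f = cp q * g -> f = g.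
Proof.
move=> q0 /(congr1 val) E; apply/val_inj; move: E; rewrite !creg_valM /=.
by apply: mulfI; rewrite tofrac_eq0.
Qed.

Lemma creg_formK H : creg_form H * inv_form alpha H = 1.
Proof.
apply/val_inj; rewrite creg_valM creg_val1 /= mulfV // tofrac_eq0.
exact: linear_poly_form_neq0.
Qed.

Lemma creg_discrP f : exists p m, cp (discr alpha ^+ m) * f = cp p.
Proof.
have [p [m E]] := cregP f; exists p, m; apply/val_inj; rewrite creg_valM E /=.
by rewrite mulrCA mulfV ?mulr1 // tofrac_eq0 discrX_neq0.
Qed.

Definition reg H f : Prop := regular_along H (val f).

(** Clears the denominator, so that regularity is witnessed by an equation inside [Creg]. *)
Lemma regP H f :
  reg H f <-> exists p q (v : V),
    [/\ v \in ssval H, eval_at v q != 0 & cp q * f = cp p].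
Proof.
split=> [[p [q [v [Hv qv E]]]]|[p [q [v [Hv qv E]]]]]; exists p, q, v; split=> //.
  apply/val_inj; rewrite creg_valM E /= mulrCA mulfV ?mulr1 // tofrac_eq0.
  by apply: contraNneq qv => ->; rewrite meval0.
move: (congr1 val E); rewrite creg_valM /= => <-; rewrite mulrAC mulfV ?mul1r //.
by rewrite tofrac_eq0; apply: contraNneq qv => ->; rewrite rmorph0.
Qed.

Lemma reg_poly H p : reg H (cp p).
Proof.
by apply/regP; exists p, 1, 0; split; rewrite ?rpred0 ?rmorph1 ?oner_neq0 ?mul1r.
Qed.

Lemma reg0 H : reg H 0.
Proof. by have := reg_poly H 0; rewrite rmorph0. Qed.

(** The product of the two denominators is still nonzero somewhere on [H], by irreducibility of
    [H]. *)
Lemma regD H f g : reg H f -> reg H g -> reg H (f + g).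
Proof.
move=> /regP [p1 [q1 [v1 [U1 h1 E1]]]] /regP [p2 [q2 [v2 [U2 h2 E2]]]].
have [v Uv hv] := nonvanishingM char0 U1 U2 h1 h2.
apply/regP; exists (p1 * q2 + q1 * p2), (q1 * q2), v; split=> //.
by rewrite rmorphM rmorphD !rmorphM /= -E1 -E2; ring.
Qed.

Lemma regM H f g : reg H f -> reg H g -> reg H (f * g).
Proof.
move=> /regP [p1 [q1 [v1 [U1 h1 E1]]]] /regP [p2 [q2 [v2 [U2 h2 E2]]]].
have [v Uv hv] := nonvanishingM char0 U1 U2 h1 h2.
apply/regP; exists (p1 * p2), (q1 * q2), v; split=> //.
by rewrite !rmorphM /= -E1 -E2; ring.
Qed.

Lemma reg_const H c : reg H (creg_const alpha c).
Proof. exact: reg_poly. Qed.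

Lemma regN H f : reg H f -> reg H (- f).
Proof.
move=> hf; rewrite -mulN1r -(rmorph1 (creg_const alpha)) -rmorphN.
by apply: regM => //; apply: reg_const.
Qed.

Lemma reg_sum H (I : Type) (r : seq I) (P : pred I) (F : I -> Creg) :
  (forall i, P i -> reg H (F i)) -> reg H (\sum_(i <- r | P i) F i).
Proof. by move=> h; apply: (big_ind (reg H)) => //; [exact: reg0|exact: regD]. Qed.

Lemma regX H f k : reg H f -> reg H (f ^+ k).
Proof.
move=> hf; elim: k => [|k IH]; first by rewrite expr0 -(rmorph1 cp); apply: reg_poly.
by rewrite exprS; apply: regM.
Qed.

Lemma reg_partial H xi f : reg H f -> reg H (creg_partial xi f).
Proof.
move=> /regP [p [q [v [U h E]]]]; apply/regP.
exists (q * poly_der xi p - poly_der xi q * p), (q * q), v; split=> //.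
  by rewrite rmorphM mulf_neq0.
have := congr1 (creg_partial xi) E; rewrite creg_partialM !creg_partial_poly => dE.
by rewrite rmorphB !rmorphM /= -dE -E; ring.
Qed.

Lemma form_row_neq0 H : alpha H != 0.
Proof.
have [v] := form_neq0 alpha H; apply: contraNneq => ->.
by rewrite mul0mx mxE.
Qed.

Lemma hyperplane_subset H H' : (ssval H <= ssval H')%VS -> H = H'.
Proof.
move=> s; apply/val_inj => /=; apply/eqP; rewrite eqEdim s /=.
have /hyperplanesP [u /eqP ru ->] := ssvalP H.
have /hyperplanesP [u' /eqP ru' ->] := ssvalP H'.
by rewrite -ltnS ru ru'.
Qed.

Lemma other_form_nonvanishing H H' : H' != H ->
  exists2 v : V, v \in ssval H & eval_at v (lform H') != 0.
Proof.
move=> HH'; have [h|/existsNP [v /not_implyP [Hv hv]]] :=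
    pselect (forall v : V, v \in ssval H -> eval_at v (lform H') = 0).
  case/eqP: HH'; apply/esym/hyperplane_subset/subvP => v /h.
  rewrite eval_linear (formP alpha) => E; apply/eqP/matrixP => i j.
  by rewrite !ord1 E mxE.
by exists v => //; apply/eqP.
Qed.

Lemma reg_inv_form H H' : H' != H -> reg H (inv_form alpha H').
Proof.
move=> /other_form_nonvanishing [v Hv hv]; apply/regP.
by exists 1, (lform H'), v; split; rewrite // rmorph1 creg_formK.
Qed.

Lemma vanish_factor H p : (forall v : V, v \in ssval H -> eval_at v p = 0) ->
  exists q, p = lform H * q.
Proof.
move=> h; apply: (linear_factor char0 (form_row_neq0 H)) => v /eqP E.
by apply: h; rewrite (formP alpha).
Qed.

Lemma eval_at_act w v p : eval_at v (poly_act W w p) = eval_at (W w^-1%g *m v) p.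
Proof.
rewrite /eval_at /poly_act comp_mpoly_meval; apply: meval_eq => i.
rewrite tnth_mktuple raddf_sum mxE; apply: eq_bigr => j _ /=.
by rewrite mevalZ mevalXU.
Qed.

Lemma stab_fixes H w v : w \in pointwise_stab H -> v \in ssval H -> W w^-1%g *m v = v.
Proof.
rewrite inE => /subvP h /h; rewrite memv_fixed => /eqP E.
by rewrite -{1}E mulmxA refl_reprKV mul1mx.
Qed.

Lemma stab_act_factor H w p : w \in pointwise_stab H ->
  exists q, poly_act W w p - p = lform H * q.
Proof.
move=> Hw; apply: vanish_factor => v Hv.
by rewrite rmorphB /= eval_at_act (stab_fixes Hw Hv) subrr.
Qed.

(** As [w] fixes [H] pointwise, [w f] and [f] agree on [H]: the numerator of their difference over
    the denominator [(w q) q] vanishes there, hence is divisible by [alpha_H]. *)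
Lemma reg_act_sub H w f : w \in pointwise_stab H -> reg H f ->
  reg H (inv_form alpha H * (creg_act w f - f)).
Proof.
move=> Hw /regP [p [q [v [U h E]]]]; apply/regP.
have [s Es] : exists s, poly_act W w p * q - p * poly_act W w q = lform H * s.
  apply: vanish_factor => u Hu; rewrite rmorphB !rmorphM /= !eval_at_act.
  by rewrite (stab_fixes Hw Hu) subrr.
exists s, (poly_act W w q * q), v; split=> //.
  by rewrite rmorphM /= mulf_neq0 // eval_at_act (stab_fixes Hw U).
have := congr1 (creg_act w) E; rewrite rmorphM /= !creg_act_poly => wE.
apply: (@creg_polyI (lform H)); first exact: linear_poly_form_neq0.
rewrite -rmorphM -Es rmorphB !rmorphM /= -wE -E.
have := creg_formK H; rewrite /creg_form => K.
transitivity (cp (lform H) * inv_form alpha H *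
  (cp (poly_act W w q) * cp q * (creg_act w f - f))); first by ring.
by rewrite K; ring.
Qed.

Lemma other_forms_nonvanishing H : exists2 v : V, v \in ssval H &
  eval_at v (\prod_(H' | H' != H) lform H') != 0.
Proof.
apply: (big_ind (fun p => exists2 v : V, v \in ssval H & eval_at v p != 0)).
- by exists 0; rewrite ?rpred0 // rmorph1 oner_neq0.
- by move=> p q [v1 U1 h1] [v2 U2 h2]; apply: nonvanishingM U1 U2 h1 h2.
- by move=> H' /other_form_nonvanishing.
Qed.

(** Only one factor of the discriminant vanishes identically on [H], so its exponent in a
    denominator of [f] bounds the order of the pole. Having all [M >= N] lets one exponent serve all
    entries of a matrix. *)
Lemma pole_bound H f : exists N, forall M, (N <= M)%N -> reg H (creg_form H ^+ M * f).
Proof.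
have [p [m E]] := creg_discrP f; exists m => M /subnK <-.
rewrite exprD -mulrA; apply: regM; first exact/regX/reg_poly.
have [v Hv hv] := other_forms_nonvanishing H.
apply/regP; exists p, ((\prod_(H' | H' != H) lform H') ^+ m), v; split=> //.
  by rewrite rmorphXn expf_neq0.
rewrite -E; have -> : discr alpha = lform H * \prod_(H' | H' != H) lform H'.
  by rewrite /discr (bigD1 H).
rewrite exprMn rmorphM !rmorphXn /=.
by rewrite -/(lform H) -/(creg_form H); ring.
Qed.

(** If [p = alpha_H f] were nonzero at a point of [H], then so would be [q p] somewhere on [H], for
    [q] a denominator of [f]; but [q p] is a multiple of [alpha_H]. Hence [alpha_H] divides [p]. *)
Lemma reg_form_poly H f : reg H f -> (exists p, creg_form H * f = cp p) ->
  exists p, f = cp p.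
Proof.
move=> /regP [p1 [q [v [Hv qv E1]]]] [p E].
have [s Es] : exists s, p = lform H * s.
  apply: vanish_factor => u Hu; apply/eqP; apply: contraT => pu.
  have [x Hx] := nonvanishingM char0 Hv Hu qv pu.
  have -> : q * p = lform H * p1.
    by apply: creg_poly_inj; rewrite !rmorphM /= -E -E1 /creg_form; ring.
  rewrite rmorphM /= [eval_at x (lform H)]eval_linear; move: Hx; rewrite (formP alpha) => /eqP ->.
  by rewrite mxE mul0r eqxx.
exists s; apply: (@creg_polyI (lform H)); first exact: linear_poly_form_neq0.
by rewrite [LHS]E Es rmorphM.
Qed.

(** The linear factors of the denominator are stripped one at a time: [step] removes one copy of the
    discriminant, and the outer induction is on its exponent. *)
Lemma reg_everywhere f : (forall H, reg H f) -> exists p, f = cp p.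
Proof.
move=> hf; have [p [m]] := creg_discrP f.
have step g : (forall H, reg H g) -> (exists p, cp (discr alpha) * g = cp p) ->
    exists p, g = cp p.
  rewrite /discr; move: (index_enum _) => r; elim: r g => [|H r IH] g hg [q].
    by rewrite big_nil rmorph1 mul1r => ->; exists q.
  rewrite big_cons rmorphM -mulrA => E; apply: IH => //.
  apply: (@reg_form_poly H); last by exists q.
  by apply: regM => //; apply: reg_poly.
elim: m p => [|m IH] p; first by rewrite expr0 rmorph1 mul1r => ->; exists p.
rewrite exprS rmorphM -mulrA => E.
have [|q] := step (cp (discr alpha ^+ m) * f) _ (ex_intro _ p E); last exact: IH.
by move=> H; apply: regM => //; apply: reg_poly.
Qed.
End LocalRegularity.

(** * Stabilizers of hyperplanes and their idempotents *)

(** The products [L M] and [M L] are both block upper triangular, with [1 + b a] and [1 + a b] as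
    the only diagonal blocks different from the identity. *)
Lemma det_rank1_update (A : comNzRingType) (n : nat) (b : 'cV[A]_n) (a : 'rV[A]_n) :
  \det (1%:M + b *m a) = 1 + (a *m b) 0 0.
Proof.
pose L : 'M[A]_(1 + n) := block_mx 1%:M 0 (- b) 1%:M.
pose M : 'M[A]_(1 + n) := block_mx 1%:M (- a) b 1%:M.
have L1 : \det L = 1 by rewrite det_lblock !det1 mulr1.
have : \det (L *m M) = \det (M *m L) by rewrite !det_mulmx mulrC.
rewrite /L /M !mulmx_block !(mul1mx, mulmx1, mul0mx, mulmx0, mulNmx, mulmxN).
rewrite !(addr0, opprK, addNr, subrr, add0r) det_ublock det_ublock.
rewrite !det1 mul1r mulr1 addrC => ->.
by rewrite det_mx11 !mxE eqxx.
Qed.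

Section Stabilizers.
Variables (C : fieldType) (n : nat) (gT : finGroupType).
Hypothesis char0 : [pchar C] =i pred0.
Variables (W : mx_representation C [set: gT] n) (alpha : defining_forms W).
Hypothesis faithfulW : mx_faithful W.
Local Notation V := 'cV[C]_n.
Implicit Types (H : hyperplane W) (w : gT).

Lemma form_normal_vector H : exists xi : V, alpha H *m xi = 1%:M.
Proof.
have [v hv] := form_neq0 alpha H; exists (((alpha H *m v) 0 0)^-1 *: v).
by rewrite -scalemxAr {2}[alpha H *m v]mx11_scalar scale_scalar_mx mulVf.
Qed.

(** [W w - 1] kills the kernel of [alpha H], so it factors through this form; [b] is its value at a
    vector [xi] where the form is 1, and [1 - xi alpha_H] projects onto [H]. *)
Lemma stab_rank1 H w : w \in pointwise_stab H ->
  exists b : V, W w = 1%:M + b *m alpha H.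
Proof.
rewrite inE => /subvP h; have [xi axi] := form_normal_vector H.
exists ((W w - 1%:M) *m xi); apply/eqP; rewrite addrC -subr_eq -mulmxA -subr_eq0.
rewrite -{1}[W w - 1%:M]mulmx1 -mulmxBr; apply/eqP/matrixP => i j.
transitivity (((W w - 1%:M) *m (1%:M - xi *m alpha H) *m delta_mx j (0 : 'I_1)) i 0).
  by rewrite -colE [RHS]mxE.
rewrite -mulmxA mulmxBl.
set v := (1%:M - _) *m _; suff : v \in fixed_space W w.
  by rewrite memv_fixed mul1mx => /eqP ->; rewrite subrr !mxE.
apply: h; rewrite (formP alpha) /v mulmxBl mul1mx mulmxBr -(mulmxA xi) (mulmxA (alpha H) xi) axi.
by rewrite mul1mx subrr.
Qed.

Local Notation sdet w := (\det (W w)).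

Lemma sdetM w u : sdet (w * u)%g = sdet w * sdet u.
Proof. by rewrite refl_reprM det_mulmx. Qed.
Lemma sdet_neq0 w : sdet w != 0.
Proof.
have : sdet w * sdet w^-1%g = 1 by rewrite -sdetM mulgV refl_repr1 det1.
by apply: contra_eqN => /eqP ->; rewrite mul0r eq_sym oner_eq0.
Qed.
Lemma sdetV w : sdet w^-1%g = (sdet w)^-1.
Proof.
apply: (mulfI (sdet_neq0 w)); rewrite -sdetM mulgV refl_repr1 det1 mulfV //.
exact: sdet_neq0.
Qed.
Lemma sdetX w k : sdet (w ^+ k)%g = sdet w ^+ k.
Proof.
elim: k => [|k IH]; first by rewrite expg0 refl_repr1 det1.
by rewrite expgS sdetM IH exprS.
Qed.

(** For [W w = 1 + b a], the eigenvalue on [a] and the determinant are both [1 + a b]. *)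
Lemma form_mul_stab H w : w \in pointwise_stab H -> alpha H *m W w = sdet w *: alpha H.
Proof.
move=> /stab_rank1 [b ->]; rewrite det_rank1_update mulmxDr mulmx1 mulmxA.
by rewrite scalerDl scale1r {1}[alpha H *m b]mx11_scalar mul_scalar_mx.
Qed.

(** Determinant 1 makes [W w = 1 + b a] a transvection, whose powers are [1 + k b a]. Finite order
    in characteristic zero forces [b a = 0], and faithfulness concludes. *)
Lemma stab_det_inj H w : w \in pointwise_stab H -> sdet w = 1 -> w = 1%g.
Proof.
move=> /stab_rank1 [b E]; rewrite E det_rank1_update => /eqP.
rewrite -subr_eq0 addrAC subrr add0r => /eqP ab.
have ab0 : alpha H *m b = 0 by rewrite [LHS]mx11_scalar ab raddf0.
have pow k : W (w ^+ k)%g = 1%:M + k%:R *: (b *m alpha H).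
  elim: k => [|k IH]; first by rewrite expg0 refl_repr1 scale0r addr0.
  rewrite expgS refl_reprM IH E mulmxDl mul1mx mulmxDr mulmx1 -scalemxAr.
  rewrite -mulmxA [alpha H *m (_ *m _)]mulmxA ab0 mul0mx mulmx0 scaler0 addr0.
  by rewrite mulrSr scalerDl scale1r addrA.
have := pow #[w]%g; rewrite expg_order refl_repr1 => /eqP.
rewrite -{1}[1%:M]addr0 (inj_eq (addrI _)) eq_sym scaler_eq0 natr_char0 //.
rewrite eqn0Ngt order_gt0 /= => /eqP b0.
apply: (mx_faithful_inj faithfulW); rewrite ?inE // refl_repr1 E b0.
by rewrite addr0.
Qed.

Lemma stab_group_set H : group_set (pointwise_stab H).
Proof.
apply/group_setP; split=> [|u w]; rewrite !inE.
  by apply/subvP => v _; rewrite memv_fixed refl_repr1 mul1mx.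
move=> /subvP hu /subvP hw; apply/subvP => v Hv; rewrite memv_fixed refl_reprM.
move: (hu v Hv) (hw v Hv); rewrite !memv_fixed => /eqP Eu /eqP Ew.
by rewrite -mulmxA Ew Eu.
Qed.
Definition stab_group H : {group gT} := Group (stab_group_set H).

Lemma stabM H u w : u \in pointwise_stab H -> w \in pointwise_stab H ->
  (u * w)%g \in pointwise_stab H.
Proof. exact: (@groupM _ (stab_group H)). Qed.
Lemma stabV H w : w \in pointwise_stab H -> w^-1%g \in pointwise_stab H.
Proof. exact: (@groupVr _ (stab_group H)). Qed.

Lemma nstab_gt0 H : (0 < nstab H)%N.
Proof. exact: (cardG_gt0 (stab_group H)). Qed.
Lemma nstab_neq0 H : (nstab H)%:R != 0 :> C.
Proof. by rewrite natr_char0 // -lt0n nstab_gt0. Qed.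

Lemma sdet_nstab H w : w \in pointwise_stab H -> sdet w ^+ nstab H = 1.
Proof.
move=> Hw; rewrite -sdetX; have := expg_cardG (G := stab_group H) Hw.
by rewrite /= -/(nstab H) => ->; rewrite refl_repr1 det1.
Qed.

(** Otherwise the determinants of the stabilizer, which are [n_H] distinct scalars, would all be
    roots of [X^(j-i) - 1], of degree less than [n_H]. *)
Lemma sdet_separates H i j : (i < nstab H)%N -> (j < nstab H)%N -> i != j ->
  exists2 w, w \in pointwise_stab H & sdet w ^+ i != sdet w ^+ j.
Proof.
wlog ij : i j / (i < j)%N => [h|_ jn _].
  move=> hi hj; rewrite neq_ltn => /orP [] ij; first by apply: h => //; rewrite ltn_eqF.
  have ji : j != i by rewrite ltn_eqF.
  by have [w Hw E] := h _ _ ij hj hi ji; exists w; rewrite // eq_sym.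
apply/exists_inP; apply: contraT; rewrite negb_exists_in => /forall_inP h.
pose P : {poly C} := 'X^(j - i) - 1%:P.
have sP : size P = (j - i).+1.
  by rewrite size_XnsubC // subn_gt0.
have P0 : P != 0 by rewrite -size_poly_eq0 sP.
have := @max_poly_roots _ P [seq sdet w | w <- enum (pointwise_stab H)] P0.
rewrite size_map -cardE -/(nstab H) sP ltnS leqNgt (leq_ltn_trans (leq_subr _ _) jn).
apply.
  apply/allP => x /mapP [w]; rewrite mem_enum => Hw ->.
  rewrite /root !hornerE subr_eq0.
  have := h w Hw; rewrite negbK -{1}(subnKC (ltnW ij)) exprD.
  rewrite -{1}[_ ^+ i]mulr1 => /eqP /(mulfI _) <- //.
  by rewrite expf_neq0 // sdet_neq0.
rewrite map_inj_in_uniq ?enum_uniq // => u w; rewrite !mem_enum => Hu Hw E.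
apply/eqP; rewrite eq_mulVg1; apply/eqP/(@stab_det_inj H).
  by rewrite stabM ?stabV.
by rewrite sdetM sdetV E mulVf ?sdet_neq0.
Qed.

(** * The idempotents of a stabilizer in a representation *)

Section Idempotents.
Variables (m : nat) (s : mx_representation C [set: gT] m) (H : hyperplane W).
Local Notation E := (rep_idem s H).

(** Translate the summation variable by [w]: [E i] projects onto the part where the stabilizer acts
    by [det^i]. *)
Lemma rep_idem_mull w i : w \in pointwise_stab H -> s w *m E i = sdet w ^+ i *: E i.
Proof.
move=> Hw; rewrite /rep_idem mulmx_sumr scaler_sumr.
rewrite [RHS](reindex_inj (mulgI w)); apply: eq_bigr => u _ /=.
rewrite -scalemxAr -repr_mxM ?inE // scalerA; congr (_ *: _).
rewrite /idem_coef.
have -> : ((w * u)%g \in pointwise_stab H) = (u \in pointwise_stab H).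
  by exact: (@groupMl _ (stab_group H)).
case: ifP => _; last by rewrite mulr0.
by rewrite sdetM exprMn invfM; field; rewrite !expf_neq0 ?sdet_neq0 ?nstab_neq0.
Qed.

Lemma rep_idem_mulr w i : w \in pointwise_stab H -> E i *m s w = sdet w ^+ i *: E i.
Proof.
move=> Hw; rewrite /rep_idem mulmx_suml scaler_sumr.
rewrite [RHS](reindex_inj (mulIg w)); apply: eq_bigr => u _ /=.
rewrite -scalemxAl -repr_mxM ?inE // scalerA; congr (_ *: _).
rewrite /idem_coef.
have -> : ((u * w)%g \in pointwise_stab H) = (u \in pointwise_stab H).
  by exact: (@groupMr _ (stab_group H)).
case: ifP => _; last by rewrite mulr0.
by rewrite sdetM exprMn invfM; field; rewrite !expf_neq0 ?sdet_neq0 ?nstab_neq0.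
Qed.

(** The coefficient of [w <> 1] is a geometric sum in [(det w)^-1], which differs from 1 and is an
    [n_H]-th root of unity; so the sum is zero. *)
Lemma rep_idem_sum : \sum_(i < nstab H) E i = 1%:M.
Proof.
rewrite /rep_idem exchange_big (bigD1 1%g) //= [X in _ + X]big1 => [|w w1].
  have H1 : 1%g \in pointwise_stab H by exact: (group1 (stab_group H)).
  rewrite addr0 -scaler_suml repr_mx1.
  under eq_bigr => i _.
    rewrite /idem_coef H1 refl_repr1 det1 expr1n invr1 mulr1; over.
  by rewrite sumr_const card_ord -[_ *+ _]mulr_natr mulVf ?nstab_neq0 // scale1r.
rewrite -scaler_suml; have [Hw|Hw] := boolP (w \in pointwise_stab H); last first.
  by rewrite big1 ?scale0r // => i _; rewrite /idem_coef (negPf Hw).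
rewrite (eq_bigr (fun i : 'I__ => (nstab H)%:R^-1 * (sdet w)^-1 ^+ i)); last first.
  by move=> i _; rewrite /idem_coef Hw exprVn.
rewrite -mulr_sumr; suff -> : \sum_(i < nstab H) (sdet w)^-1 ^+ i = 0.
  by rewrite mulr0 scale0r.
have /eqP := subrX1 (sdet w)^-1 (nstab H).
rewrite exprVn sdet_nstab // invr1 subrr eq_sym mulf_eq0 subr_eq0 invr_eq1.
by case/orP => [/eqP /(stab_det_inj Hw) E1|/eqP //]; rewrite E1 eqxx in w1.
Qed.

(** Insert an element [w] on which the two characters differ and move it to either side. *)
Lemma rep_idem_orth i j : (i < nstab H)%N -> (j < nstab H)%N -> i != j ->
  E i *m E j = 0.
Proof.
move=> hi hj ij; have [w Hw hw] := sdet_separates hi hj ij.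
have : E i *m (s w *m E j) = (E i *m s w) *m E j by rewrite mulmxA.
rewrite rep_idem_mull // rep_idem_mulr // -scalemxAr -scalemxAl => /eqP.
by rewrite -subr_eq0 -scalerBl scaler_eq0 subr_eq0 eq_sym (negPf hw) => /eqP.
Qed.

Lemma rep_idem_idem i : (i < nstab H)%N -> E i *m E i = E i.
Proof.
move=> hi; rewrite -[RHS]mulmx1 -rep_idem_sum [RHS]mulmx_sumr.
rewrite [RHS](bigD1 (Ordinal hi)) //= [X in _ = _ + X]big1 ?addr0 // => j ij.
by apply: rep_idem_orth => //; rewrite eq_sym.
Qed.

Lemma rep_idemM (i j : 'I_(nstab H)) : E i *m E j = (i == j)%:R *: E i.
Proof.
have [<-|ij] := eqVneq; first by rewrite rep_idem_idem // scale1r.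
by rewrite rep_idem_orth ?scale0r.
Qed.

(** In a rank factorization of an idempotent, the factors multiplied in the other order give the
    identity. The use of this is that residues have integral trace. *)
Lemma rep_idem_trace i : (i < nstab H)%N -> \tr (E i) = (\rank (E i))%:R.
Proof.
move=> /rep_idem_idem; move: (E i) => P PP.
have : col_base P *m (row_base P *m col_base P) *m row_base P = col_base P *m 1%:M *m row_base P.
  by rewrite mulmx1 mulmxA mulmx_base -[P *m _ *m _]mulmxA mulmx_base.
move/(row_free_inj (row_base_free P)).
have /row_fullP [L LC] : row_full (col_base P) by exact: col_base_full.
move/(congr1 (mulmx L)); rewrite mulmx1 (mulmxA L (col_base P)) LC mul1mx => RC.
by rewrite -{1}(mulmx_base P) mxtrace_mulC RC mxtrace1.
Qed.
End Idempotents.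
End Stabilizers.

(** * Absence of poles for equivariant flat matrices *)

(** Between eigenspaces of [R] and [S] the operator acts by a scalar. A component can survive at the
    pole only where this scalar vanishes. *)
Lemma weight_component (C : fieldType) (A : comNzRingType) (c : {rmorphism C -> A})
    (p q : nat) (Q : 'M[A]_(p, q)) (E R : 'M[C]_p) (F S : 'M[C]_q) (x y : C) (N : nat) :
  E *m R = x *: E -> S *m F = y *: F ->
  map_mx c E *m (Q *+ N + Q *m map_mx c S - map_mx c R *m Q) *m map_mx c F =
  c (N%:R + y - x) *: (map_mx c E *m Q *m map_mx c F).
Proof.
move=> ER SF; rewrite mulmxBr mulmxBl mulmxDr mulmxDl.
have -> : map_mx c E *m (Q *m map_mx c S) *m map_mx c F =
    c y *: (map_mx c E *m Q *m map_mx c F).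
  by rewrite -(mulmxA (map_mx c E)) -(mulmxA Q) -map_mxM SF map_mxZ -!scalemxAr mulmxA.
have -> : map_mx c E *m (map_mx c R *m Q) *m map_mx c F =
    c x *: (map_mx c E *m Q *m map_mx c F).
  by rewrite mulmxA -map_mxM ER map_mxZ -!scalemxAl.
by rewrite -scaler_nat -scalemxAr -scalemxAl rmorphB rmorphD /= rmorph_nat scalerBl scalerDl.
Qed.

Section MatrixRegularity.
Variables (C : fieldType) (n : nat) (gT : finGroupType).
Hypothesis char0 : [pchar C] =i pred0.
Variables (W : mx_representation C [set: gT] n) (alpha : defining_forms W).
Hypothesis faithfulW : mx_faithful W.
Variable k : multiplicity W.
Local Notation V := 'cV[C]_n.
Local Notation Creg := (Creg alpha).
Local Notation const := (creg_const alpha).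
Local Notation cmx := (map_mx const).
Local Notation dmx xi := (map_mx (creg_partial xi)).
Implicit Types (H : hyperplane W).

Lemma intr_char0 (c : int) : (c%:~R == 0 :> C) = (c == 0).
Proof.
case: c => c; rewrite ?NegzE ?mulrNz ?oppr_eq0 -pmulrn natr_char0 //.
Qed.

Lemma partial_sum (xi : V) (I : Type) (r : seq I) (P : pred I) (F : I -> Creg) :
  creg_partial xi (\sum_(i <- r | P i) F i) = \sum_(i <- r | P i) creg_partial xi (F i).
Proof.
apply: (big_morph (creg_partial xi)); first exact: creg_partialD.
by rewrite -(rmorph0 const) creg_partial_const rmorph0.
Qed.

Lemma dmxM (xi : V) p q r (A : 'M[Creg]_(p, q)) (B : 'M_(q, r)) :
  dmx xi (A *m B) = dmx xi A *m B + A *m dmx xi B.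
Proof.
apply/matrixP => i j; rewrite !mxE partial_sum -big_split; apply: eq_bigr => l _ /=.
by rewrite creg_partialM !mxE.
Qed.

Lemma dmx_const (xi : V) p q (A : 'M[C]_(p, q)) : dmx xi (cmx A) = 0.
Proof. by apply/matrixP => i j; rewrite !mxE creg_partial_const. Qed.

Lemma dmxZ (xi : V) p q f (A : 'M[Creg]_(p, q)) :
  dmx xi (f *: A) = creg_partial xi f *: A + f *: dmx xi A.
Proof. by apply/matrixP => i j; rewrite !mxE creg_partialM. Qed.

Lemma partial_form (xi : V) H :
  creg_partial xi (creg_form alpha H) = const ((alpha H *m xi) 0 0).
Proof. by rewrite creg_partial_poly poly_der_linear. Qed.

(** The extra factor [f] avoids the exponent [N - 1] and a separate case [N = 0]. *)
Lemma partial_exp (xi : V) (f : Creg) N :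
  creg_partial xi (f ^+ N) * f = creg_partial xi f * f ^+ N *+ N.
Proof.
elim: N => [|N IH]; first by rewrite expr0 mulr0n -(rmorph1 const) creg_partial_const mul0r.
rewrite exprS creg_partialM mulrDl -[f * _ * f]mulrA IH mulrS; congr (_ + _); first by ring.
by rewrite mulrnAr; congr (_ *+ _); ring.
Qed.

Definition mreg H p q (A : 'M[Creg]_(p, q)) : Prop := forall i j, reg H (A i j).

Lemma mregD H p q (A B : 'M_(p, q)) : mreg H A -> mreg H B -> mreg H (A + B).
Proof. by move=> hA hB i j; rewrite mxE; apply: regD. Qed.
Lemma mregN H p q (A : 'M_(p, q)) : mreg H A -> mreg H (- A).
Proof. by move=> hA i j; rewrite mxE; apply: regN. Qed.
Lemma mregM H p q r (A : 'M_(p, q)) (B : 'M_(q, r)) :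
  mreg H A -> mreg H B -> mreg H (A *m B).
Proof. by move=> hA hB i j; rewrite mxE; apply: reg_sum => // l _; apply: regM. Qed.
Lemma mregZ H p q f (A : 'M_(p, q)) : reg H f -> mreg H A -> mreg H (f *: A).
Proof. by move=> hf hA i j; rewrite mxE; apply: regM. Qed.
Lemma mreg_const H p q (A : 'M[C]_(p, q)) : mreg H (cmx A).
Proof. by move=> i j; rewrite mxE; apply: reg_const. Qed.
Lemma mreg0 H p q : mreg H (0 : 'M_(p, q)).
Proof. by move=> i j; rewrite mxE; apply: reg0. Qed.
Lemma mreg_sum H p q (I : Type) (r : seq I) (P : pred I) (F : I -> 'M_(p, q)) :
  (forall i, P i -> mreg H (F i)) -> mreg H (\sum_(i <- r | P i) F i).
Proof.
move=> h; apply: (big_ind (@mreg H p q)) => //; [exact: mreg0|exact: mregD].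
Qed.
Lemma mreg_dmx H (xi : V) p q (A : 'M_(p, q)) : mreg H A -> mreg H (dmx xi A).
Proof. by move=> hA i j; rewrite mxE; apply: reg_partial. Qed.
Definition kz_weight H (i : nat) : int := (nstab H)%:Z * k H i.
Definition residue m (s : mx_representation C [set: gT] m) H : 'M[C]_m :=
  \sum_(i < nstab H) rep_idem s H i *~ kz_weight H i.

Lemma idem_residue m (s : mx_representation C [set: gT] m) H (i : 'I_(nstab H)) :
  rep_idem s H i *m residue s H = (kz_weight H i)%:~R *: rep_idem s H i.
Proof.
rewrite /residue mulmx_sumr (bigD1 i) //= [X in _ + X]big1 => [|j ji].
  by rewrite addr0 -scaler_int -scalemxAr rep_idemM // eqxx scale1r.
by rewrite -scaler_int -scalemxAr rep_idemM // eq_sym (negPf ji) scale0r scaler0.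
Qed.

Lemma residue_idem m (s : mx_representation C [set: gT] m) H (i : 'I_(nstab H)) :
  residue s H *m rep_idem s H i = (kz_weight H i)%:~R *: rep_idem s H i.
Proof.
rewrite /residue mulmx_suml (bigD1 i) //= [X in _ + X]big1 => [|j ji].
  by rewrite addr0 -scaler_int -scalemxAl rep_idemM // eqxx scale1r.
by rewrite -scaler_int -scalemxAl rep_idemM // (negPf ji) scale0r scaler0.
Qed.

Lemma act_form H w : w \in pointwise_stab H ->
  creg_act w (creg_form alpha H) = const (\det (W w))^-1 * creg_form alpha H.
Proof.
move=> Hw; rewrite creg_act_poly poly_act_linear (form_mul_stab _ (stabV Hw)).
by rewrite linear_polyZ sdetV -mul_mpolyC rmorphM.
Qed.

Lemma reg_div_form H (c : C) f g : c != 0 -> const c * f = creg_form alpha H * g ->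
  reg H g -> reg H (inv_form alpha H * f).
Proof.
move=> c0 E hg; have -> : inv_form alpha H * f = const c^-1 * g; last first.
  exact: (regM char0 (reg_const _ _ _) hg).
rewrite -[g]mul1r -(creg_formK alpha H) mulrAC -E -[f in LHS]mul1r -(rmorph1 const).
by rewrite -(mulVf c0) rmorphM; ring.
Qed.

(** The action of [w] is trivial on [H], so two different weights force [f] to vanish there:
    [(y - x) f = x (w f - f)]. *)
Lemma reg_div_form_weight H w (x y : C) f : w \in pointwise_stab H -> x != y ->
  const x * creg_act w f = const y * f -> reg H f -> reg H (inv_form alpha H * f).
Proof.
move=> Hw xy E hf; have yx : y - x != 0 by rewrite subr_eq0 eq_sym.
have hg := reg_act_sub char0 Hw hf.
apply: (reg_div_form yx _ (regM char0 (reg_const alpha H x) hg)).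
set g := creg_act w f in E *; rewrite rmorphB mulrBl -E -mulrBr.
transitivity (creg_form alpha H * inv_form alpha H * (const x * (g - f))); last by ring.
by rewrite creg_formK mul1r.
Qed.

(** * Lowering the pole order of an equivariant solution along one hyperplane *)

Section Descent.
Variables (p q : nat) (s : mx_representation C [set: gT] p).
Variables (r : mx_representation C [set: gT] q) (H : hyperplane W).
Variables (P : 'M[Creg]_(p, q)) (xi : V) (R1 : 'M[Creg]_p) (R2 : 'M[Creg]_q).
Local Notation a := (creg_form alpha H).
Local Notation ai := (inv_form alpha H).
Hypothesis a_xi : alpha H *m xi = 1%:M.
Hypothesis P_equiv : forall w, w \in pointwise_stab H ->
  cmx (s w) *m map_mx (creg_act w) P = P *m cmx (r w).
Hypothesis R1_reg : mreg H R1.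
Hypothesis R2_reg : mreg H R2.
(** The two-sided shape, with regular error terms [R1] and [R2], covers both the gauged fundamental
    matrix and its inverse. *)
Hypothesis P_ode : a *: dmx xi P =
  P *m cmx (residue r H) - cmx (residue s H) *m P + a *: (R1 *m P + P *m R2).

(** Since [alpha_H] has derivative 1 along [xi], the factor [a ^+ N] only adds [N] to the residue
    part. *)
Lemma scale_ode N : let Q := a ^+ N *: P in a *: dmx xi Q =
  Q *+ N + Q *m cmx (residue r H) - cmx (residue s H) *m Q + a *: (R1 *m Q + Q *m R2).
Proof.
move=> Q; rewrite /Q dmxZ scalerDr scalerA mulrC partial_exp partial_form a_xi.
rewrite mxE eqxx rmorph1 mul1r -scalerMnl -!addrA; congr (_ + _).
rewrite scalerA mulrC -scalerA P_ode -!scalemxAr -!scalemxAl.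
by rewrite !scalerDr scalerN !scalerA [a * _]mulrC -!addrA.
Qed.

Local Notation component i Q j :=
  (cmx (rep_idem s H i) *m Q *m cmx (rep_idem r H j)).

Lemma component_ode N (i j : 'I_(nstab H)) : mreg H (a ^+ N *: P) ->
  exists2 S : 'M[Creg]_(p, q), mreg H S &
    const (N%:Z + kz_weight H j - kz_weight H i)%:~R *: component i (a ^+ N *: P) j = a *: S.
Proof.
set Q := a ^+ N *: P => Qreg.
exists (component i (dmx xi Q - R1 *m Q - Q *m R2) j).
  apply: (mregM (mregM (mreg_const _ _) _) (mreg_const _ _)).
  apply: (mregD); last by apply/mregN/(mregM).
  by apply: (mregD); [exact: mreg_dmx|apply/mregN/(mregM)].
rewrite [RHS]scalemxAl [in RHS]scalemxAr.
have -> : a *: (dmx xi Q - R1 *m Q - Q *m R2) =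
    Q *+ N + Q *m cmx (residue r H) - cmx (residue s H) *m Q.
  by rewrite -addrA -opprD scalerBr scale_ode -/Q addrK.
have := weight_component const Q N (idem_residue s i) (residue_idem r j).
by move=> ->; rewrite intrB intrD.
Qed.

(** [w] multiplies [a ^+ N] by [(det w)^(-N) = 1], so the scaled matrix is still equivariant, and
    the idempotents turn the two representations into characters. *)
Lemma component_act N (i j : 'I_(nstab H)) w : w \in pointwise_stab H ->
  \det (W w) ^+ N = 1 ->
  const (\det (W w) ^+ i) *: map_mx (creg_act w) (component i (a ^+ N *: P) j) =
  const (\det (W w) ^+ j) *: component i (a ^+ N *: P) j.
Proof.
move=> Hw dN; set Q := a ^+ N *: P.
have wQ : cmx (s w) *m map_mx (creg_act w) Q = Q *m cmx (r w).
  have -> : map_mx (creg_act w) Q = a ^+ N *: map_mx (creg_act w) P.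
    apply/matrixP => u v; rewrite !mxE rmorphM /= rmorphXn /= act_form // exprMn -rmorphXn.
    by rewrite exprVn dN invr1 rmorph1 mul1r.
  by rewrite -scalemxAr P_equiv // scalemxAl.
have cE m1 m2 (A : 'M[C]_(m1, m2)) : map_mx (creg_act w) (cmx A) = cmx A.
  by apply/matrixP => u v; rewrite !mxE creg_act_const.
clearbody Q; rewrite !map_mxM /= !cE 2!scalemxAl -map_mxZ.
rewrite -(rep_idem_mulr char0 s i Hw) map_mxM -!(mulmxA (cmx (rep_idem s H i))).
by rewrite wQ -(mulmxA Q) -map_mxM (rep_idem_mull char0 r j Hw) map_mxZ -!scalemxAr.
Qed.

(** The equation makes a component divisible by [a] unless its scalar vanishes; in that resonant
    case the stabilizer does. *)
Lemma component_descent N (i j : 'I_(nstab H)) : (0 < N)%N ->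
  mreg H (a ^+ N *: P) -> mreg H (ai *: component i (a ^+ N *: P) j).
Proof.
move=> N0 Qreg; have [S Sreg E] := component_ode i j Qreg.
have Qij_reg : mreg H (component i (a ^+ N *: P) j).
  exact: (mregM (mregM (mreg_const _ _) Qreg) (mreg_const _ _)).
have [c0|c0] := eqVneq (N%:Z + kz_weight H j - kz_weight H i) 0; last first.
  move=> u v; rewrite mxE; have := congr1 (fun X : 'M_(p, q) => X u v) E.
  rewrite [LHS]mxE [RHS]mxE => Euv.
  by apply: (reg_div_form _ Euv (Sreg u v)); rewrite intr_char0.
(* For [i = j] the resonance would read [N = 0]. *)
have ij : i != j :> nat.
  apply/eqP => /val_inj ij; move/eqP: c0; rewrite ij addrK.
  by rewrite eqz_nat eqn0Ngt N0.
have [w Hw hw] := sdet_separates char0 alpha faithfulW (ltn_ord i) (ltn_ord j) ij.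
(* All weights are multiples of [n_H], hence so is their difference [N]. *)
have dN : \det (W w) ^+ N = 1.
  have /dvdnP [l ->] : (nstab H %| N)%N.
    have : (nstab H %| N%:Z)%Z.
      have -> : N%:Z = (nstab H)%:Z * (k H i - k H j).
        by move/eqP: c0; rewrite /kz_weight subr_eq0 mulrBr => /eqP <-; rewrite addrK.
      by rewrite dvdz_mulr.
    by [].
  by rewrite mulnC exprM (sdet_nstab Hw) expr1n.
move=> u v; rewrite mxE; have := congr1 (fun X : 'M_(p, q) => X u v) (component_act i j Hw dN).
rewrite [LHS]mxE [RHS]mxE [X in _ * X = _]mxE => Euv.
exact: (reg_div_form_weight Hw hw Euv (Qij_reg u v)).
Qed.

Lemma pole_descent N : mreg H (a ^+ N *: P) -> mreg H P.
Proof.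
elim: N => [|N IH]; first by rewrite scale1r.
move=> h; apply: IH; have -> : a ^+ N *: P = ai *: (a ^+ N.+1 *: P).
  by rewrite scalerA exprS mulrA [ai * _]mulrC creg_formK mul1r.
(* Resolve the identity into idempotents on both sides and divide each component by [a]. *)
have -> : a ^+ N.+1 *: P = \sum_(i < nstab H) \sum_(j < nstab H)
    component i (a ^+ N.+1 *: P) j.
  under eq_bigr => i _ do rewrite -mulmx_sumr.
  rewrite -mulmx_suml -mulmx_suml -!raddf_sum /= !(rep_idem_sum char0 alpha faithfulW).
  by rewrite !map_mx1 mul1mx mulmx1.
rewrite scaler_sumr; apply: mreg_sum => i _; rewrite scaler_sumr; apply: mreg_sum => j _.
exact: component_descent.
Qed.

Lemma local_regularity : mreg H P.
Proof.
have /choice [N hN] : forall ij : 'I_p * 'I_q, exists N, forall M, (N <= M)%N ->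
  reg H (a ^+ M * P ij.1 ij.2) by move=> ij; apply: pole_bound.
apply: (@pole_descent (\max_ij N ij)) => i j; rewrite mxE.
by apply: (hN (i, j)); apply: leq_bigmax.
Qed.
End Descent.
End MatrixRegularity.

(** * Flat sections *)

Lemma derivation_prod (A : comNzRingType) (d : A -> A) (I : finType) (F : I -> A) :
  d 1 = 0 -> (forall x y, d (x * y) = d x * y + x * d y) ->
  d (\prod_i F i) = \sum_i d (F i) * \prod_(j | j != i) F j.
Proof.
move=> d1 dM.
(* Lists without duplicates, because the omitted factor is singled out by [j != i]. *)
have gen (r : seq I) : uniq r ->
    d (\prod_(i <- r) F i) = \sum_(i <- r) d (F i) * \prod_(j <- r | j != i) F j.
  elim: r => [|i r IH] /=; first by rewrite !big_nil d1.
  move=> /andP [ir ur]; rewrite !big_cons dM IH // eqxx; congr (_ + _).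
    congr (_ * _); rewrite big_seq [RHS]big_seq_cond; apply: eq_bigl => j.
    by case jr: (j \in r) => //=; apply/esym; apply: contraNneq ir => <-.
  rewrite mulr_sumr big_seq [RHS]big_seq; apply: eq_bigr => j jr.
  rewrite big_cons; have -> : i != j by apply: contraNneq ir => ->.
  by rewrite mulrCA.
by rewrite gen ?index_enum_uniq.
Qed.

(** Jacobi's formula: the Leibniz rule differentiates one row at a time, and expansion along that
    row produces the cofactors. *)
Lemma derivation_det (A : comNzRingType) (d : {additive A -> A}) (m : nat) (Y : 'M[A]_m) :
  d 1 = 0 -> (forall x y, d (x * y) = d x * y + x * d y) ->
  d (\det Y) = \tr (map_mx d Y *m \adj Y).
Proof.
move=> d1 dM; have dS (b : bool) x : d ((-1) ^+ b * x) = (-1) ^+ b * d x.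
  by rewrite dM; case: b; rewrite ?raddfN /= ?expr1 ?expr0 ?raddfN /= d1 ?oppr0 mul0r add0r.
rewrite /determinant raddf_sum.
under eq_bigr => s _ do rewrite /= dS (derivation_prod _ d1 dM) mulr_sumr.
rewrite exchange_big /mxtrace; apply: eq_bigr => k _ /=.
have -> : (map_mx d Y *m \adj Y) k k = \sum_j d (Y k j) * cofactor Y k j.
  by rewrite mxE; apply: eq_bigr => j _; rewrite !mxE.
(* [Y] with row [k] differentiated; the cofactors along this row are those of [Y]. *)
pose Z : 'M[A]_m := \matrix_(i, j) if i == k then d (Y i j) else Y i j.
transitivity (\det Z).
  apply: eq_bigr => s _; rewrite [in RHS](bigD1 k) //= mxE eqxx; congr (_ * (_ * _)).
  by apply: eq_bigr => j /negPf jk; rewrite mxE jk.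
rewrite (expand_det_row Z k); apply: eq_bigr => j _; rewrite !mxE eqxx; congr (_ * _).
rewrite /cofactor; congr (_ * \det _); apply/matrixP => x y; rewrite !mxE.
by rewrite eq_sym (negPf (neq_lift _ _)).
Qed.

Section FlatSections.
Variables (C : fieldType) (n : nat) (gT : finGroupType).
Hypothesis char0 : [pchar C] =i pred0.
Variables (W : mx_representation C [set: gT] n) (alpha : defining_forms W).
Local Notation V := 'cV[C]_n.
Local Notation CV := {mpoly C[n]}.
Local Notation Creg := (Creg alpha).
Local Notation cp := (creg_poly alpha).
Local Notation const := (creg_const alpha).
Local Notation cmx := (map_mx const).
Local Notation dmx xi := (map_mx (creg_partial xi)).
Local Notation D := (discr alpha).
Implicit Types (H : hyperplane W).

Lemma common_denominator p q (A : 'M[Creg]_(p, q)) :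
  exists N B, cp (D ^+ N) *: A = map_mx cp B.
Proof.
have /choice [f hf] : forall ij : 'I_p * 'I_q, exists z : CV * nat,
    cp (D ^+ z.2) * A ij.1 ij.2 = cp z.1.
  by move=> ij; have [a [N E]] := creg_discrP (A ij.1 ij.2); exists (a, N).
pose N := \max_ij (f ij).2.
exists N, (\matrix_(i, j) (D ^+ (N - (f (i, j)).2) * (f (i, j)).1)).
apply/matrixP => i j; rewrite !mxE rmorphM /= -(hf (i, j)) mulrA -rmorphM -exprD subnK //.
exact: (leq_bigmax (i, j)).
Qed.

(* Restricted to a line through [v], and multiplied by a power of the discriminant, the
   equation is a linear ODE whose leading coefficient does not vanish at [v]. *)
Lemma flat_vanish m (A : V -> 'M[Creg]_m) (y : 'cV[Creg]_m) N (P : 'cV[CV]_m) (v : V) :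
  (forall xi, dmx xi y = A xi *m y) -> cp (D ^+ N) *: y = map_mx cp P ->
  eval_at v D != 0 -> (forall i, eval_at v (P i 0) = 0) -> y = 0.
Proof.
move=> ode yP Dv Pv; have P0 : P = 0.
  apply/matrixP => i j; rewrite ord1 {j} [RHS]mxE; apply: (mpoly_vanishes char0) => u.
  pose xi := u - v; have [M [B AB]] := common_denominator (A xi).
  (* Differentiate [P = D^N y] and multiply by [D^(M+1)], using [B = D^M A]. *)
  pose E := (D ^+ M * poly_der xi D *+ N)%:M + D *: B.
  have odeP : (D ^+ M.+1) *: map_mx (poly_der xi) P = E *m P.
    suff : map_mx cp ((D ^+ M.+1) *: map_mx (poly_der xi) P) = map_mx cp (E *m P).
      move/matrixP => h; apply/matrixP => x z; apply: (@creg_poly_inj _ _ _ _ alpha).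
      by move: (h x z); rewrite !mxE.
    have dP : map_mx cp (map_mx (poly_der xi) P) =
        creg_partial xi (cp (D ^+ N)) *: y + cp (D ^+ N) *: (A xi *m y).
      rewrite -ode -dmxZ yP; apply/matrixP => x z.
      by rewrite !mxE creg_partial_poly.
    rewrite map_mxZ dP map_mxM -yP rmorphD /= map_mxZ -AB map_scalar_mx mulmxDl mul_scalar_mx.
    rewrite scalerDr !scalerA -!scalemxAl -!scalemxAr !scalerA; congr (_ *: _ + _ *: _).
      have := partial_exp xi (cp D) N; rewrite -!rmorphXn /= => h.
      rewrite exprS rmorphM mulrAC -[cp D * _]mulrC h.
      rewrite raddfMn /= !rmorphM /= !mulrnAl creg_partial_poly; congr (_ *+ _).
      by rewrite mulrC mulrA.
    by rewrite exprS !rmorphM.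
  have g0 : map_mx (on_line v xi) P = 0.
    apply: (@linear_ode_unique _ _ (on_line v xi (D ^+ M.+1)) (map_mx (on_line v xi) E) _ char0).
    - move=> l; rewrite -map_mxM -odeP !mxE on_line_der rmorphM /=.
      by [].
    - rewrite -horner_coef0 on_line0 rmorphXn /= expf_neq0 //.
    - by move=> l; rewrite mxE -horner_coef0 on_line0.
  have := on_lineE v xi (P i 0) 1; rewrite scale1r subrKC => <-.
  by have /matrixP /(_ i 0) := g0; rewrite !mxE => ->; rewrite horner0.
apply/matrixP => i j; apply: (@creg_polyI _ _ _ _ _ (D ^+ N)); first exact: discrX_neq0.
by have /matrixP /(_ i j) := yP; rewrite P0 !mxE mulr0 rmorph0.
Qed.

Lemma regular_point : exists v : V, eval_at v D != 0.
Proof. by apply: nonvanishing => //; apply: discr_neq0. Qed.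

(** Subtract the value [c] of [f] at a regular point: the difference is flat for the trivial system
    and vanishes at that point. *)
Lemma constant_creg (f : Creg) : (forall xi, creg_partial xi f = 0) ->
  exists c, f = const c.
Proof.
move=> df; have [v Dv] := regular_point; have [p [N E]] := creg_discrP f.
pose c := eval_at v p / eval_at v D ^+ N; exists c.
suff h : const_mx (f - const c) = 0 :> 'cV[Creg]_1.
  by apply/eqP; rewrite -subr_eq0; move/matrixP: h => /(_ 0 0); rewrite !mxE => ->.
apply: (@flat_vanish _ (fun=> 0) _ N (const_mx (p - D ^+ N * c%:MP)) v) => //.
- move=> xi; rewrite mul0mx; apply/matrixP => i j; rewrite !mxE.
  by rewrite creg_partialD df -rmorphN /= creg_partial_const addr0.
- by apply/matrixP => i j; rewrite !mxE mulrBr E rmorphB /= [in RHS]rmorphM.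
- move=> i; rewrite mxE rmorphB rmorphM rmorphXn /= eval_atC /c.
  by rewrite mulrC divfK ?subrr // expf_neq0.
Qed.

(** Integer powers of [alpha_H] without leaving [Creg]; [Negz N] stands for [- (N + 1)]. *)
Definition form_pow H (z : int) : Creg :=
  match z with Posz N => creg_form alpha H ^+ N | Negz N => inv_form alpha H ^+ N.+1 end.

Lemma val_form_pow H z : val (form_pow H z) = (tofrac (linear_poly (alpha H))) ^ z.
Proof.
have vX (f : Creg) N : val (f ^+ N) = val f ^+ N.
  by elim: N => [|N IH]; rewrite ?expr0 // !exprS creg_valM IH.
by case: z => N; rewrite /= vX // /= exprVn.
Qed.

Lemma form_powD H x y : form_pow H (x + y) = form_pow H x * form_pow H y.
Proof.
apply/val_inj; rewrite creg_valM !val_form_pow expfzDr // tofrac_eq0.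
exact: linear_poly_form_neq0.
Qed.

Lemma form_powNK H z : form_pow H (- z) * form_pow H z = 1.
Proof. by rewrite -form_powD addNr. Qed.

Lemma partial_form_pow xi H z :
  creg_partial xi (form_pow H z) = z%:~R * dlog_form alpha H xi * form_pow H z.
Proof.
have nat_case (N : nat) : creg_partial xi (form_pow H N) =
    N%:R * dlog_form alpha H xi * form_pow H N.
  rewrite -[LHS]mulr1 -[X in _ * X = _](creg_formK alpha H) mulrA partial_exp partial_form.
  by rewrite /dlog_form /form_pow -mulr_natl; ring.
case: z => N; first by rewrite nat_case.
(* Negative exponents: differentiate the product of [b] with its inverse power. *)
rewrite NegzE; set b := form_pow H (- N.+1%:Z).
have E : b * form_pow H N.+1 = 1 by exact: form_powNK.
have := congr1 (creg_partial xi) E; rewrite creg_partialM nat_case.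
have -> : creg_partial xi (1 : Creg) = 0.
  by rewrite -(rmorph1 const) creg_partial_const.
move=> /eqP; rewrite addr_eq0 => /eqP dE.
transitivity (creg_partial xi b * form_pow H N.+1 * b).
  by rewrite -mulrA [_ * b]mulrC E mulr1.
by rewrite dE [b * _]mulrCA E mulr1 rmorphN /= -pmulrn !mulNr.
Qed.
End FlatSections.

(** * The KZ system *)

Lemma mulmx_delta_inj (C A : pzRingType) (c : {rmorphism C -> A}) (p q : nat)
    (M N : 'M[A]_(p, q)) :
  (forall u : 'cV[C]_q, M *m map_mx c u = N *m map_mx c u) -> M = N.
Proof.
move=> h; apply/matrixP => i j; have := h (delta_mx j 0).
by rewrite map_delta_mx -!colE => /matrixP /(_ i 0); rewrite !mxE.
Qed.

Section KZ.
Variables (C : fieldType) (n : nat) (gT : finGroupType).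
Hypothesis char0 : [pchar C] =i pred0.
Variables (W : mx_representation C [set: gT] n) (alpha : defining_forms W).
Hypothesis faithfulW : mx_faithful W.
Variable k : multiplicity W.
Local Notation V := 'cV[C]_n.
Local Notation CV := {mpoly C[n]}.
Local Notation Creg := (Creg alpha).
Local Notation cp := (creg_poly alpha).
Local Notation const := (creg_const alpha).
Local Notation cmx := (map_mx const).
Local Notation dmx xi := (map_mx (creg_partial xi)).
Local Notation D := (discr alpha).
Implicit Types (H : hyperplane W) (xi : V).

Section KZMatrix.
Variables (m : nat) (s : mx_representation C [set: gT] m).

Definition kz_matrix xi : 'M[Creg]_m :=
  \sum_H dlog_form alpha H xi *: cmx (residue k s H).

Lemma residue_act H (y : 'cV[Creg]_m) :
  \sum_(i < nstab H) idem_act s H i y *~ ((nstab H)%:Z * k H i) = cmx (residue k s H) *m y.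
Proof.
rewrite /residue raddf_sum mulmx_suml; apply: eq_bigr => i _.
by rewrite /idem_act raddfMz /= -!scaler_int scalemxAl.
Qed.

Lemma kz_solutionE (y : 'cV[Creg]_m) :
  kz_solution k s y <-> forall xi, dmx xi y = - kz_matrix xi *m y.
Proof.
have E xi : \sum_H dlog_form alpha H xi *:
    \sum_(i < nstab H) idem_act s H i y *~ ((nstab H)%:Z * k H i) = kz_matrix xi *m y.
  rewrite /kz_matrix mulmx_suml; apply: eq_bigr => H _.
  by rewrite residue_act scalemxAl.
split=> h xi; have := h xi; rewrite E mulNmx => /eqP; rewrite ?addr_eq0.
  by move/eqP.
by move=> /eqP ->; rewrite addNr.
Qed.

(** The trace of the residue as an integer, each idempotent counting its rank. Minus this number
    will be the exponent of [alpha_H] in [det Y]. *)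
Definition kz_exponent H : int :=
  \sum_(i < nstab H) kz_weight k H i * (\rank (rep_idem s H i))%:Z.

Lemma residue_trace H : \tr (residue k s H) = (kz_exponent H)%:~R.
Proof.
rewrite /residue raddf_sum [in RHS]rmorph_sum; apply: eq_bigr => i _ /=.
by rewrite raddfMz /= (rep_idem_trace char0 alpha faithfulW) // intrM -mulrzl.
Qed.

Lemma kz_matrix_trace xi :
  \tr (kz_matrix xi) = \sum_H (kz_exponent H)%:~R * dlog_form alpha H xi.
Proof.
rewrite /kz_matrix raddf_sum; apply: eq_bigr => H _ /=.
by rewrite mxtraceZ trace_map_mx residue_trace rmorph_int mulrC.
Qed.

Lemma kz_matrix_at H xi : alpha H *m xi = 1%:M ->
  exists2 R, mreg H R & kz_matrix xi = inv_form alpha H *: cmx (residue k s H) + R.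
Proof.
move=> axi; exists (\sum_(H' | H' != H) dlog_form alpha H' xi *: cmx (residue k s H')).
  apply: (mreg_sum char0) => H' HH'; apply: mregZ; [exact: char0| |exact: mreg_const].
  by apply: (regM char0); [exact: reg_const|exact: reg_inv_form].
rewrite /kz_matrix (bigD1 H) //=; congr (_ *: _ + _).
by rewrite /dlog_form axi mxE eqxx rmorph1 mul1r.
Qed.
End KZMatrix.

(** * Gauge matrices, the model solutions near a hyperplane *)

Section Gauge.
Variables (m : nat) (s : mx_representation C [set: gT] m) (H : hyperplane W).

(* The matrix [alpha_H ^ (e * residue)]. *)
Definition gauge (e : int) : 'M[Creg]_m :=
  \sum_(i < nstab H) form_pow alpha H (e * kz_weight k H i) *: cmx (rep_idem s H i).

Lemma gaugeM e f : gauge e *m gauge f = gauge (e + f).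
Proof.
rewrite /gauge mulmx_suml; apply: eq_bigr => i _.
rewrite mulmx_sumr (bigD1 i) //= [X in _ + X]big1 => [|j ji].
  rewrite addr0 -scalemxAl -scalemxAr scalerA -form_powD -mulrDl -map_mxM.
  by rewrite (rep_idemM char0 alpha faithfulW) eqxx scale1r.
rewrite -scalemxAl -scalemxAr -map_mxM (rep_idemM char0 alpha faithfulW) eq_sym (negPf ji).
by rewrite scale0r map_mx0 !scaler0.
Qed.

Lemma gauge0 : gauge 0 = 1%:M.
Proof.
rewrite /gauge; under eq_bigr => i _ do rewrite mul0r /= expr0 scale1r.
by rewrite -raddf_sum /= (rep_idem_sum char0 alpha faithfulW) map_mx1.
Qed.

Lemma residue_gauge e : cmx (residue k s H) *m gauge e =
  \sum_(i < nstab H) ((kz_weight k H i)%:~R * form_pow alpha H (e * kz_weight k H i)) *: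
    cmx (rep_idem s H i).
Proof.
rewrite /gauge mulmx_sumr; apply: eq_bigr => i _.
rewrite -scalemxAr -map_mxM (residue_idem char0 alpha faithfulW) map_mxZ scalerA.
by rewrite rmorph_int mulrC.
Qed.

Lemma gauge_residue e : gauge e *m cmx (residue k s H) = cmx (residue k s H) *m gauge e.
Proof.
rewrite residue_gauge /gauge mulmx_suml; apply: eq_bigr => i _.
rewrite -scalemxAl -map_mxM (idem_residue char0 alpha faithfulW) map_mxZ scalerA.
by rewrite rmorph_int mulrC.
Qed.

Lemma dmx_gauge xi e : alpha H *m xi = 1%:M ->
  creg_form alpha H *: dmx xi (gauge e) = e%:~R *: (cmx (residue k s H) *m gauge e).
Proof.
move=> axi; rewrite residue_gauge /gauge scaler_sumr.
have -> : dmx xi (\sum_(i < nstab H) form_pow alpha H (e * kz_weight k H i) *: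
      cmx (rep_idem s H i)) = \sum_(i < nstab H)
    creg_partial xi (form_pow alpha H (e * kz_weight k H i)) *: cmx (rep_idem s H i).
  apply/matrixP => x y; rewrite mxE !summxE partial_sum; apply: eq_bigr => i _.
  by rewrite !mxE creg_partialM creg_partial_const mulr0 addr0.
rewrite scaler_sumr; apply: eq_bigr => i _; rewrite !scalerA; congr (_ *: _).
rewrite partial_form_pow /dlog_form axi mxE eqxx rmorph1 mul1r intrM.
rewrite -[RHS]mul1r -(creg_formK alpha H); set fp := form_pow _ _ _; ring.
Qed.

(** [w] scales [alpha_H] by an [n_H]-th root of unity, so the exponent has to be a multiple of
    [n_H]; negative powers follow by inversion. *)
Lemma act_form_pow w z : w \in pointwise_stab H ->
  creg_act w (form_pow alpha H ((nstab H)%:Z * z)) = form_pow alpha H ((nstab H)%:Z * z).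
Proof.
move=> Hw.
have nat_case N : creg_act w (form_pow alpha H (nstab H * N)%N) = form_pow alpha H (nstab H * N)%N.
  rewrite /form_pow rmorphXn /= act_form // exprMn -rmorphXn exprVn exprM sdet_nstab //.
  by rewrite expr1n invr1 rmorph1 mul1r.
case: z => N; first by rewrite -PoszM nat_case.
rewrite NegzE mulrN -PoszM; set M := (_ * _)%N.
have E : form_pow alpha H (- M%:Z) * form_pow alpha H M = 1 by exact: form_powNK.
have := congr1 (creg_act w) E; rewrite rmorphM rmorph1 /= [X in _ * X]nat_case => wE.
rewrite -[LHS]mulr1 -[X in _ * X = _]E mulrCA [creg_act _ _ * _]wE mulr1 //.
Qed.

(** The entries are invariant because the exponents are multiples of [n_H], and [s w] acts by the
    same scalar on both sides of each idempotent. *)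
Lemma act_gauge w e : w \in pointwise_stab H ->
  cmx (s w) *m map_mx (creg_act w) (gauge e) = gauge e *m cmx (s w).
Proof.
move=> Hw; have -> : map_mx (creg_act w) (gauge e) = gauge e.
  apply/matrixP => x y; rewrite mxE !summxE raddf_sum; apply: eq_bigr => i _.
  by rewrite !mxE /= rmorphM /= creg_act_const /kz_weight mulrCA act_form_pow.
rewrite /gauge mulmx_sumr mulmx_suml; apply: eq_bigr => i _.
rewrite -scalemxAl -scalemxAr -!map_mxM.
by rewrite (rep_idem_mull char0 _ _ Hw) (rep_idem_mulr char0 _ _ Hw).
Qed.
End Gauge.

(** * The fundamental matrix, its inverse, and quasi-invariants *)

Section FundamentalMatrix.
Variables (m : nat) (tau tau' : mx_representation C [set: gT] m).
Variable Y : 'M[Creg]_m.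
Hypothesis Y_inj : injective (fun u : 'cV[C]_m => Y *m cmx u).
Hypothesis Y_flat : forall xi, dmx xi Y = - kz_matrix tau' xi *m Y.
Hypothesis Y_equiv : forall w,
  cmx (tau' w) *m map_mx (creg_act w) Y = Y *m cmx (tau w).

(** If [det Y = 0], some constant [u <> 0] is killed by [Y] at a regular point. The flat section
    [Y u] vanishes there, hence everywhere, against injectivity. *)
Lemma fundamental_det_neq0 : \det Y != 0.
Proof.
apply/eqP => dY; have [v Dv] := regular_point char0 alpha.
have [N [B YB]] := common_denominator Y.
have dB : \det B = 0.
  apply: (@creg_poly_inj _ _ _ _ alpha); rewrite -det_map_mx -YB rmorph0.
  by rewrite detZ dY mulr0.
(* Transposed, because [det0P] yields a row vector in the left kernel. *)
have : \det (map_mx (eval_at v) B)^T == 0 by rewrite det_tr det_map_mx dB rmorph0.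
case/det0P => u u0 uB; case/negP: u0; rewrite -[u]trmxK.
suff -> : u^T = 0 by rewrite trmx0.
apply: Y_inj => /=; rewrite map_mx0 mulmx0.
apply: (flat_vanish char0 (A := fun xi => - kz_matrix tau' xi) (N := N)
  (P := B *m map_mx (@mpolyC n C) u^T) (v := v)) => //.
- by move=> xi; rewrite dmxM dmx_const mulmx0 addr0 Y_flat mulmxA.
- rewrite scalemxAl YB map_mxM; congr (_ *m _); apply/matrixP => i j; rewrite !mxE //.
- move=> i; transitivity ((u *m (map_mx (eval_at v) B)^T) 0 i); last by rewrite uB mxE.
  rewrite !mxE rmorph_sum; apply: eq_bigr => l _.
  by rewrite !mxE rmorphM /= eval_atC mulrC.
Qed.

(** The logarithmic derivatives of [g] and [det Y] are [tr A] and [- tr A], so their product is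
    constant, and [g] is a product of powers of the [alpha_H]. *)
Lemma fundamental_det_unit : exists e : Creg, e * \det Y = 1.
Proof.
pose g := \prod_H form_pow alpha H (kz_exponent tau' H).
have dg xi : creg_partial xi g = \tr (kz_matrix tau' xi) * g.
  rewrite /g kz_matrix_trace mulr_suml.
  have d1 : creg_partial xi (1 : Creg) = 0.
    by rewrite -(rmorph1 const) creg_partial_const.
  rewrite (derivation_prod _ d1 (creg_partialM xi)); apply: eq_bigr => H _.
  by rewrite partial_form_pow [X in _ = _ * X](bigD1 H) //= -[LHS]mulrA.
have dY xi : creg_partial xi (\det Y) = - \tr (kz_matrix tau' xi) * \det Y.
  have d1 : creg_partial xi (1 : Creg) = 0.
    by rewrite -(rmorph1 const) creg_partial_const.
  (* Jacobi's formula takes an additive map; the one underlying [partial_op] is convertible to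
     [creg_partial xi]. *)
  pose d : {additive Creg -> Creg} := lendo_fun (partial_op alpha xi).
  transitivity (\tr (map_mx d Y *m \adj Y)).
    exact: (@derivation_det _ d _ Y d1 (creg_partialM xi)).
  have -> : map_mx d Y = dmx xi Y by [].
  by rewrite Y_flat -mulmxA mul_mx_adj mul_mx_scalar mxtraceZ raddfN mulrC.
have [c Ec] : exists c, \det Y * g = const c.
  apply: (constant_creg char0) => xi; rewrite creg_partialM dg dY; ring.
(* The inverse of [g]: with it, [c = 0] would give [det Y = 0]. *)
pose gi := \prod_H form_pow alpha H (- kz_exponent tau' H).
have gK : g * gi = 1.
  rewrite /g /gi -big_split big1 // => H _ /=.
  by rewrite mulrC form_powNK.
have c0 : c != 0.
  apply: contra_neq fundamental_det_neq0 => c0.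
  by rewrite -[LHS]mulr1 -gK mulrA Ec c0 rmorph0 mul0r.
exists (const c^-1 * g).
by rewrite -mulrA [g * _]mulrC Ec -rmorphM mulVf // rmorph1.
Qed.

Lemma fundamental_inverse : exists X : 'M[Creg]_m, Y *m X = 1%:M /\ X *m Y = 1%:M.
Proof.
have [e eY] := fundamental_det_unit; exists (e *: \adj Y).
by rewrite -scalemxAr -scalemxAl mul_mx_adj mul_adj_mx scale_scalar_mx eY.
Qed.

Variable X : 'M[Creg]_m.
Hypothesis YX : Y *m X = 1%:M.
Hypothesis XY : X *m Y = 1%:M.

Lemma inverse_equiv w : cmx (tau w) *m map_mx (creg_act w) X = X *m cmx (tau' w).
Proof.
rewrite -[LHS]mul1mx -XY -mulmxA [Y *m _]mulmxA -Y_equiv -!mulmxA -map_mxM YX map_mx1.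
by rewrite mulmx1.
Qed.

(** Differentiate [Y X = 1]. The KZ matrix moves to the right of [X], the form in which the Dunkl
    operators kill the columns of [X]. *)
Lemma inverse_flat xi : dmx xi X = X *m kz_matrix tau' xi.
Proof.
have /eqP : dmx xi (Y *m X) = 0 by rewrite YX -(map_mx1 const) dmx_const.
rewrite dmxM Y_flat -mulmxA YX mulmx1 addrC subr_eq0 => /eqP E.
by rewrite -[LHS]mul1mx -XY -mulmxA E.
Qed.

(** The equation of [Y] gives the residue for [tau'] on the left, the gauge that for [tau] on the
    right; the rest [- R] of the system is regular along [H]. *)
Lemma gauged_regular H : mreg H (Y *m gauge tau H 1).
Proof.
have [xi axi] := form_normal_vector alpha H; have [R Rreg EA] := kz_matrix_at tau' axi.
apply: (local_regularity char0 faithfulW (k := k) (s := tau') (r := tau) axi _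
  (mregN char0 Rreg) (@mreg0 _ _ _ _ alpha H m m)).
  move=> w Hw; rewrite map_mxM mulmxA Y_equiv -mulmxA act_gauge //.
  by rewrite mulmxA.
rewrite dmxM Y_flat scalerDr (scalemxAr _ Y) (dmx_gauge tau 1 axi) scale1r.
rewrite -gauge_residue (mulmxA Y); set Z := Y *m gauge tau H 1.
have -> : creg_form alpha H *: (- kz_matrix tau' xi *m Y *m gauge tau H 1) =
    - (cmx (residue k tau' H) *m Z) + creg_form alpha H *: (- R *m Z).
  rewrite -mulmxA -/Z !mulNmx !scalerN scalemxAl EA scalerDr scalerA creg_formK scale1r.
  by rewrite mulmxDl opprD -scalemxAl.
by rewrite mulmx0 addr0 [LHS]addrC addrA.
Qed.

Lemma gauged_inverse_regular H : mreg H (gauge tau H (- 1) *m X).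
Proof.
have [xi axi] := form_normal_vector alpha H; have [R Rreg EA] := kz_matrix_at tau' axi.
apply: (local_regularity char0 faithfulW (k := k) (s := tau) (r := tau') axi _
  (@mreg0 _ _ _ _ alpha H m m) Rreg).
  move=> w Hw; rewrite map_mxM mulmxA act_gauge // -mulmxA inverse_equiv.
  by rewrite mulmxA.
rewrite dmxM inverse_flat scalerDr scalemxAl (dmx_gauge tau (- 1) axi).
rewrite scaleN1r mulNmx -(mulmxA (cmx _)) (mulmxA (gauge _ _ _) X).
set Z := gauge tau H (- 1) *m X.
have -> : creg_form alpha H *: (Z *m kz_matrix tau' xi) =
    Z *m cmx (residue k tau' H) + creg_form alpha H *: (Z *m R).
  by rewrite scalemxAr EA scalerDr scalerA creg_formK scale1r mulmxDr -scalemxAr.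
by rewrite mul0mx add0r addrA [- _ + _]addrC.
Qed.

(** [gauge (- 1) phi] is the sum over [i] of the vectors that must be regular, and the constant
    idempotents recover the summands. *)
Lemma quasi_invariant_gauge (phi : 'cV[Creg]_m) :
  quasi_invariant (phi : reg_module alpha k tau) <->
  forall H, mreg H (gauge tau H (- 1) *m phi).
Proof.
have E H i j : regular_along H
    ((tofrac (linear_poly (alpha H))) ^ (- ((nstab H)%:Z * k H i)) *
      creg_val (idem_act tau H i phi j 0)) <->
    reg H ((form_pow alpha H (- kz_weight k H i) *: (cmx (rep_idem tau H i) *m phi)) j 0).
  by rewrite [X in reg H X]mxE /reg creg_valM val_form_pow.
split=> [h H|h H i hi j].
  rewrite /gauge mulmx_suml; apply: (mreg_sum char0) => i _ j l; rewrite ord1 {l}.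
  by rewrite mulN1r -scalemxAl; apply/E; apply: h.
apply/E; have := mregM char0 (mreg_const alpha H (rep_idem tau H i)) (h H).
move=> /(_ j 0); congr (reg H (_ j 0)); rewrite mulmxA; pose io := Ordinal hi.
rewrite /gauge mulmx_sumr mulmx_suml (bigD1 io) //= [X in _ + X]big1 => [|l li].
  rewrite addr0 mulN1r -scalemxAr -map_mxM -scalemxAl.
  by rewrite (rep_idem_idem char0 alpha faithfulW).
rewrite -scalemxAr -map_mxM (rep_idem_orth char0 alpha faithfulW) ?map_mx0 ?scaler0 ?mul0mx //.
by rewrite eq_sym.
Qed.

(** With [G] the gauge at [H], use [Y phi = (Y G) (G^-1 phi)] and [G^-1 phi = (G^-1 X) (Y phi)],
    whose first factors are regular along [H]. A vector regular along all hyperplanes is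
    polynomial. *)
Lemma quasi_invariant_poly (phi : 'cV[Creg]_m) :
  quasi_invariant (phi : reg_module alpha k tau) <->
  exists p : 'cV[CV]_m, Y *m phi = map_mx cp p.
Proof.
rewrite quasi_invariant_gauge; split=> [h|[p Ep] H].
  have /choice [p hp] : forall i, exists p, (Y *m phi) i 0 = cp p.
    move=> i; apply: (reg_everywhere char0) => H.
    have -> : Y *m phi = (Y *m gauge tau H 1) *m (gauge tau H (- 1) *m phi).
      by rewrite -mulmxA (mulmxA (gauge tau H 1)) gaugeM subrr gauge0 mul1mx.
    by apply: (mregM char0) (h H) _ _; apply: gauged_regular.
  by exists (\col_i p i); apply/matrixP => i j; rewrite ord1 hp !mxE.
rewrite -[phi]mul1mx -XY -(mulmxA X) Ep mulmxA.
apply: (mregM char0) (gauged_inverse_regular H) _ => i j.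
by rewrite mxE; apply: reg_poly.
Qed.
End FundamentalMatrix.
End KZ.

(** * Commutators with Dunkl operators *)

Section CrossedCoefficients.
Variables (A : pzRingType) (gT : finGroupType) (act : ring_action A gT).
Local Notation coef := (crossed_coef act).
Local Notation grp := (crossed_grp act).

Lemma crossed_mulE (x y : crossed act) g :
  (x * y) g = \sum_h x h * ra_fun act h (y (h^-1 * g)%g).
Proof. by rewrite [LHS]ffunE. Qed.

Lemma crossed_coef_mul a (y : crossed act) g : (coef a * y) g = a * y g.
Proof.
rewrite crossed_mulE (bigD1 1%g) //= big1 => [|h /negPf h1].
  by rewrite ffunE eqxx ra_1 invg1 mul1g addr0.
by rewrite ffunE h1 mul0r.
Qed.

Lemma crossed_coefB : zmod_morphism coef.
Proof.
by move=> a b; apply/ffunP => g; rewrite !ffunE; case: ifP => _ //; rewrite subr0.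
Qed.

Lemma crossed_coefM a b : coef (a * b) = coef a * coef b.
Proof.
apply/ffunP => g; rewrite [RHS]crossed_coef_mul !ffunE; case: ifP => _ //.
by rewrite mulr0.
Qed.

Lemma crossed_coef1 : coef 1 = 1.
Proof. by apply/ffunP => g; rewrite !ffunE; case: ifP. Qed.

Lemma crossed_grp_coef w a : grp w * coef a = coef (ra_fun act w a) * grp w.
Proof.
apply/ffunP => g; rewrite [RHS]crossed_coef_mul crossed_mulE.
rewrite (bigD1 w) //= big1 => [|h /negPf hw]; last by rewrite ffunE hw mul0r.
rewrite !ffunE eqxx mul1r addr0 -eq_mulVg1 [w == g]eq_sym.
by case: ifP => _; rewrite ?mulr1 // rmorph0 mulr0.
Qed.
End CrossedCoefficients.

Lemma commutator_sum (A : pzRingType) (I : finType) (d f : A) (g : I -> A) (z : I -> int) :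
  d * f = f * d ->
  d * (\sum_i g i *~ z i) * f - f * (d * (\sum_i g i *~ z i)) =
  \sum_i (d * (g i * f - f * g i)) *~ z i.
Proof.
move=> df; rewrite mulrA -df -!mulrA -mulrBr mulr_suml mulr_sumr -sumrB mulr_sumr.
by apply: eq_bigr => i _; rewrite mulrzAl mulrzAr -mulrzBl mulrzAr.
Qed.

Section DunklCommutator.
Variables (C : fieldType) (n : nat) (gT : finGroupType).
Hypothesis char0 : [pchar C] =i pred0.
Variables (W : mx_representation C [set: gT] n) (alpha : defining_forms W).
Variable k : multiplicity W.
Local Notation V := 'cV[C]_n.
Local Notation CV := {mpoly C[n]}.
Local Notation Creg := (Creg alpha).
Local Notation cp := (creg_poly alpha).
Local Notation const := (creg_const alpha).
Local Notation DW := (DW alpha).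
Implicit Types (H : hyperplane W) (xi : V) (w : gT) (f g : Creg).

Lemma DW_fun_is_zmod_morphism : zmod_morphism (@DW_fun C n gT W alpha).
Proof.
move=> f g; rewrite /DW_fun -crossed_coefB; congr crossed_coef.
by apply/val_inj/lendoP => h; exact: mulrBl.
Qed.
HB.instance Definition _ := GRing.isZmodMorphism.Build Creg DW
  (@DW_fun C n gT W alpha) DW_fun_is_zmod_morphism.

Lemma DW_funM f g : DW_fun (f * g) = DW_fun f * DW_fun g.
Proof.
rewrite /DW_fun -crossed_coefM; congr crossed_coef.
by apply/val_inj/lendoP => h; exact: (esym (mulrA f g h)).
Qed.

Lemma DW_fun1 : DW_fun (1 : Creg) = 1.
Proof.
rewrite /DW_fun -(crossed_coef1 (diffop_action alpha)); congr crossed_coef.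
by apply/val_inj/lendoP => h; exact: mul1r.
Qed.

Lemma DW_grp_fun w f : DW_grp alpha w * DW_fun f = DW_fun (creg_act w f) * DW_grp alpha w.
Proof.
rewrite /DW_grp /DW_fun crossed_grp_coef; congr (crossed_coef _ _ * _).
apply/val_inj/lendoP => h; transitivity (creg_act w (f * creg_act w^-1%g h)); first by [].
by rewrite rmorphM /= -creg_actM mulgV creg_act1.
Qed.

Lemma DW_partial_fun xi f : DW_partial alpha xi * DW_fun f =
  DW_fun f * DW_partial alpha xi + DW_fun (creg_partial xi f).
Proof.
have -> : DW_fun (creg_partial xi f) =
    DW_partial alpha xi * DW_fun f - DW_fun f * DW_partial alpha xi.
  rewrite /DW_partial /DW_fun -!crossed_coefM -crossed_coefB; congr crossed_coef.
  apply/val_inj/lendoP => h; transitivity (creg_partial xi (f * h) - f * creg_partial xi h).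
    by rewrite creg_partialM addrK.
  by [].
by rewrite addrC subrK.
Qed.

(** Membership in the subspace [C[V] * W]. *)
Definition poly_grp (x : DW) : Prop :=
  exists h : gT -> CV, x = \sum_w DW_fun (cp (h w)) * DW_grp alpha w.

Lemma poly_grpB x y : poly_grp x -> poly_grp y -> poly_grp (x - y).
Proof.
move=> [h ->] [l ->]; exists (fun w => h w - l w).
by rewrite -sumrB; apply: eq_bigr => w _; rewrite -mulrBl !raddfB.
Qed.

Lemma poly_grp0 : poly_grp 0.
Proof. by exists (fun=> 0); rewrite big1 // => w _; rewrite !raddf0 mul0r. Qed.

Lemma poly_grpN x : poly_grp x -> poly_grp (- x).
Proof. by move=> hx; rewrite -sub0r; apply: poly_grpB => //; apply: poly_grp0. Qed.

Lemma poly_grpD x y : poly_grp x -> poly_grp y -> poly_grp (x + y).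
Proof. by move=> hx hy; rewrite -[y]opprK; apply: poly_grpB => //; apply: poly_grpN. Qed.

Lemma poly_grp_sum (I : finType) (F : I -> DW) :
  (forall i, poly_grp (F i)) -> poly_grp (\sum_i F i).
Proof. by move=> h; apply: (big_ind poly_grp) => //; [exact: poly_grp0|exact: poly_grpD]. Qed.

Lemma poly_grpMz x z : poly_grp x -> poly_grp (x *~ z).
Proof.
move=> hx; have hn N : poly_grp (x *+ N).
  by elim: N => [|N IH]; rewrite ?mulrS; [exact: poly_grp0|exact: poly_grpD].
by case: z => N; [exact: hn|exact/poly_grpN/hn].
Qed.

Lemma poly_grp_poly p : poly_grp (DW_fun (cp p)).
Proof.
exists (fun w => if w == 1%g then p else 0); rewrite (bigD1 1%g) //= big1 => [|w /negPf ->].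
  rewrite eqxx addr0; have -> : DW_grp alpha 1 = 1 :> DW by [].
  by rewrite mulr1.
by rewrite !raddf0 mul0r.
Qed.

(* [(w p - p) / alpha_H] is polynomial for [w] in [W_H]. *)
Lemma idem_commutator H i xi p :
  poly_grp (DW_fun (dlog_form alpha H xi) *
    (DW_grpalg alpha (idem_coef H i) * DW_fun (cp p) -
     DW_fun (cp p) * DW_grpalg alpha (idem_coef H i))).
Proof.
rewrite /DW_grpalg mulr_suml mulr_sumr -sumrB mulr_sumr.
(* After [w] is moved past [p], its coefficient in the commutator contains [w p - p]; it is zero for
   [w] outside the stabilizer. *)
have : forall w, exists q,
    dlog_form alpha H xi * (const (idem_coef H i w) * (creg_act w (cp p) - cp p)) = cp q.
  move=> w; rewrite /idem_coef; case: ifP => [Hw|_]; last first.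
    by exists 0; rewrite rmorph0 mul0r mulr0 rmorph0.
  have [q Eq] := stab_act_factor char0 alpha p Hw.
  set c := (X in const X); exists (((alpha H *m xi) 0 0)%:MP * c%:MP * q).
  rewrite creg_act_poly -rmorphB Eq !rmorphM /= /dlog_form -/(creg_form alpha H).
  rewrite -[RHS]mul1r -(creg_formK alpha H) /creg_const; ring.
case/choice => h hh; exists h; apply: eq_bigr => w _; rewrite -hh.
set c := const _; set G := DW_grp _ _; set F := cp p.
rewrite -(mulrA (DW_fun c) G) DW_grp_fun -/G (mulrA (DW_fun c)) (mulrA (DW_fun F)).
rewrite -mulrBl -(DW_funM c) -(DW_funM F) -raddfB /= [LHS]mulrA -DW_funM [F * c]mulrC.
by rewrite [c * (_ - _)]mulrBr.
Qed.

(** The derivation contributes the derivative of [p], and each idempotent a term of [C[V] * W]. *)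
Lemma dunkl_commutator xi p :
  poly_grp (dunkl alpha k xi * DW_fun (cp p) - DW_fun (cp p) * dunkl alpha k xi).
Proof.
have zmod_id (U : zmodType) (a b c d : U) : a + d - b - (a - c) = d - (b - c).
  by rewrite !opprB addrA addrC !addrA addNr add0r addrAC.
rewrite /dunkl mulrBl mulrBr DW_partial_fun zmod_id.
apply: poly_grpD; first by rewrite creg_partial_poly; apply: poly_grp_poly.
apply: poly_grpN; rewrite mulr_suml mulr_sumr -sumrB; apply: poly_grp_sum => H.
rewrite commutator_sum -?DW_funM 1?[cp p * _]mulrC //.
by apply: poly_grp_sum => i; apply/poly_grpMz/idem_commutator.
Qed.
End DunklCommutator.

(** * The standard module *)

Section StandardModule.
Variables (C : fieldType) (n : nat) (gT : finGroupType).
Hypothesis char0 : [pchar C] =i pred0.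
Variables (W : mx_representation C [set: gT] n) (alpha : defining_forms W).
Variable k : multiplicity W.
Local Notation V := 'cV[C]_n.
Local Notation CV := {mpoly C[n]}.
Local Notation Creg := (Creg alpha).
Local Notation cp := (creg_poly alpha).
Local Notation const := (creg_const alpha).
Local Notation cmx := (map_mx const).
Local Notation DW := (DW alpha).
Local Notation Hk := (Hk alpha k).
Local Notation Hp := (Hk_poly alpha k).
Local Notation Hg := (Hk_grp alpha k).
Local Notation Hd := (Hk_dunkl alpha k).
Implicit Types (H : hyperplane W) (xi : V) (w : gT) (p q : CV).

Lemma Hk_valE (x y : Hk) : gs_val x = gs_val y -> x = y.
Proof. exact: val_inj. Qed.

Lemma Hk_polyB : zmod_morphism Hp.
Proof.
move=> p q; apply: Hk_valE; transitivity (DW_fun (cp p) - DW_fun (cp q)) => //.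
by rewrite -!raddfB.
Qed.
HB.instance Definition _ := GRing.isZmodMorphism.Build CV Hk Hp Hk_polyB.

Lemma Hk_polyM p q : Hp (p * q) = Hp p * Hp q.
Proof.
apply: Hk_valE; transitivity (DW_fun (cp p) * DW_fun (cp q)) => //.
by rewrite -DW_funM -rmorphM.
Qed.

Lemma Hk_poly1 : Hp 1 = 1.
Proof.
apply: Hk_valE; transitivity (DW_fun (1 : Creg)); last exact: DW_fun1.
by rewrite -(rmorph1 cp).
Qed.

Lemma Hk_grp_poly w p : Hg w * Hp p = Hp (poly_act W w p) * Hg w.
Proof.
apply: Hk_valE; transitivity (DW_grp alpha w * DW_fun (cp p)) => //.
by rewrite DW_grp_fun creg_act_poly.
Qed.

Lemma Hk_dunkl_poly xi p : exists h : gT -> CV,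
  Hd xi * Hp p = Hp p * Hd xi + \sum_w Hp (h w) * Hg w.
Proof.
have [h E] := dunkl_commutator char0 alpha k xi p; exists h.
apply/eqP; rewrite addrC -subr_eq; apply/eqP/Hk_valE.
transitivity (dunkl alpha k xi * DW_fun (cp p) - DW_fun (cp p) * dunkl alpha k xi) => //.
rewrite E; apply/esym.
by apply: (big_morph (fun x : Hk => gs_val x : DW)).
Qed.

Section Span.
Variables (m : nat) (s : mx_representation C [set: gT] m).
Local Notation M := (standard_module alpha k s).

Definition std_gen (j : 'I_m) : M := qm_proj (standard_rel s) (delta_mx 0 j).

Lemma std_span (x : 'rV[Hk]_m) :
  qm_proj (standard_rel s) x = \sum_j x 0 j *: std_gen j.
Proof.
rewrite {1}[x]row_sum_delta raddf_sum; apply: eq_bigr => j _ /=.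
exact: linearZ.
Qed.

Lemma pure_tensor_delta (h : Hk) (j : 'I_m) :
  pure_tensor h (delta_mx j 0) = h *: (delta_mx 0 j : 'rV_m).
Proof.
apply/rowP => l; rewrite !mxE eqxx andbT /=; case: eqP => _.
  by rewrite Hk_poly1 !mulr1.
by rewrite raddf0 !mulr0.
Qed.

Lemma grp_std_gen w j : Hg w *: std_gen j = \sum_i Hp (s w i j)%:MP *: std_gen i.
Proof.
rewrite -linearZ /=.
transitivity (qm_proj (standard_rel s) (pure_tensor (1 : Hk) (s w *m delta_mx j 0))).
  apply/qm_projP/Mspan_gen; left; exists w, (delta_mx j 0).
  by rewrite pure_tensor_delta.
rewrite std_span; apply: eq_bigr => i _; rewrite mxE mul1r -colE mxE //.
Qed.

Lemma dunkl_std_gen xi j : Hd xi *: std_gen j = 0.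
Proof.
rewrite -linearZ /= -(raddf0 (qm_proj (standard_rel s))); apply/qm_projP.
rewrite subr0; apply/Mspan_gen; right; exists xi, (delta_mx j 0).
by rewrite pure_tensor_delta.
Qed.

Definition poly_span (x : M) : Prop :=
  exists p : 'cV[CV]_m, x = \sum_j Hp (p j 0) *: std_gen j.

Lemma poly_spanB x y : poly_span x -> poly_span y -> poly_span (x - y).
Proof.
move=> [p ->] [q ->]; exists (p - q); rewrite -sumrB; apply: eq_bigr => j _.
by rewrite !mxE raddfB scalerBl.
Qed.
Lemma poly_span0 : poly_span 0.
Proof. by exists 0; rewrite big1 // => j _; rewrite mxE raddf0 scale0r. Qed.
Lemma poly_spanD x y : poly_span x -> poly_span y -> poly_span (x + y).
Proof.
move=> hx hy; have := poly_spanB poly_span0 hy; rewrite sub0r => hN.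
by rewrite -[y]opprK; apply: poly_spanB.
Qed.
Lemma poly_span_sum (I : finType) (F : I -> M) :
  (forall i, poly_span (F i)) -> poly_span (\sum_i F i).
Proof. by move=> h; apply: (big_ind poly_span) => //; [exact: poly_span0|exact: poly_spanD]. Qed.

Lemma poly_span_poly p x : poly_span x -> poly_span (Hp p *: x).
Proof.
move=> [q ->]; exists (p *: q); rewrite scaler_sumr; apply: eq_bigr => j _.
by rewrite scalerA mxE Hk_polyM.
Qed.
Lemma poly_span_gen j : poly_span (std_gen j).
Proof.
exists (delta_mx j 0); rewrite (bigD1 j) //= big1 => [|i /negPf ij].
  by rewrite mxE !eqxx Hk_poly1 scale1r addr0.
by rewrite mxE ij raddf0 scale0r.
Qed.

Lemma poly_span_grp w x : poly_span x -> poly_span (Hg w *: x).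
Proof.
move=> [q ->]; rewrite scaler_sumr; apply: poly_span_sum => j.
rewrite scalerA Hk_grp_poly -scalerA grp_std_gen; apply/poly_span_poly/poly_span_sum => i.
exact/poly_span_poly/poly_span_gen.
Qed.

(** In [T_xi p u = p T_xi u + [T_xi, p] u] the first term vanishes in the standard module and the
    commutator lies in [C[V] * W]. *)
Lemma poly_span_dunkl xi x : poly_span x -> poly_span (Hd xi *: x).
Proof.
move=> [q ->]; rewrite scaler_sumr; apply: poly_span_sum => j.
rewrite scalerA; have [h ->] := Hk_dunkl_poly xi (q j 0).
rewrite scalerDl -scalerA dunkl_std_gen scaler0 add0r scaler_suml; apply: poly_span_sum => w.
by rewrite -scalerA; apply/poly_span_poly/poly_span_grp/poly_span_gen.
Qed.

Lemma poly_span_Hk (h : Hk) x : poly_span x -> poly_span (h *: x).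
Proof.
case: h => d dP; have dS : subring_span (Hk_gen k) d by exact/asboolP.
(* The membership proof is generalized because subterms carry other proofs, and [x] because a
   product acts by its right factor first. *)
elim: dS dP x => {d} [d dg||d e dS IHd eS IHe|d e dS IHd eS IHe] dP x hx.
- case: dg => [[p E]|[w E]|[xi E]].
  + by have -> : GeneratedSubring dP = Hp p; [exact: Hk_valE|exact: poly_span_poly].
  + by have -> : GeneratedSubring dP = Hg w; [exact: Hk_valE|exact: poly_span_grp].
  + by have -> : GeneratedSubring dP = Hd xi; [exact: Hk_valE|exact: poly_span_dunkl].
- by have -> : GeneratedSubring dP = 1; [exact: Hk_valE|rewrite scale1r].
- have -> : GeneratedSubring dP =
      GeneratedSubring (asboolT dS) - GeneratedSubring (asboolT eS) by exact: Hk_valE.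
  by rewrite scalerBl; apply: poly_spanB; [exact: IHd|exact: IHe].
- have -> : GeneratedSubring dP =
      GeneratedSubring (asboolT dS) * GeneratedSubring (asboolT eS) by exact: Hk_valE.
  by rewrite -scalerA; apply/IHd/IHe.
Qed.

Lemma standard_module_span x : poly_span x.
Proof.
rewrite -(qm_repr x) std_span; apply: poly_span_sum => j.
exact/poly_span_Hk/poly_span_gen.
Qed.
End Span.
End StandardModule.

(** * The isomorphism *)

Section DunklAction.
Variables (C : fieldType) (n : nat) (gT : finGroupType).
Hypothesis char0 : [pchar C] =i pred0.
Variables (W : mx_representation C [set: gT] n) (alpha : defining_forms W).
Variable k : multiplicity W.
Local Notation V := 'cV[C]_n.
Local Notation CV := {mpoly C[n]}.
Local Notation Creg := (Creg alpha).
Local Notation cp := (creg_poly alpha).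
Local Notation const := (creg_const alpha).
Local Notation cmx := (map_mx const).
Local Notation dmx xi := (map_mx (creg_partial xi)).
Local Notation DW := (DW alpha).
Local Notation Hk := (Hk alpha k).
Variables (m : nat) (tau : mx_representation C [set: gT] m).

(** [DW_act] with its arguments exchanged, so that additivity in the operator becomes a morphism
    structure. *)
Definition act_on (phi : 'cV[Creg]_m) (x : DW) : 'cV[Creg]_m := DW_act tau x phi.

Lemma act_on_is_zmod_morphism phi : zmod_morphism (act_on phi).
Proof.
move=> x y; rewrite /act_on /DW_act -sumrB; apply: eq_bigr => w _.
by rewrite !ffunE; apply/matrixP => i j; rewrite !mxE.
Qed.
HB.instance Definition _ phi := GRing.isZmodMorphism.Build DW 'cV[Creg]_m (act_on phi)
  (act_on_is_zmod_morphism phi).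

Lemma act_onM phi x y : act_on phi (x * y) = act_on (act_on phi y) x.
Proof. by rewrite /act_on DW_actA. Qed.

Lemma act_on_fun phi f : act_on phi (DW_fun f) = f *: phi.
Proof. exact: DW_act_fun. Qed.

Lemma act_on_grpalg phi c :
  act_on phi (DW_grpalg alpha c) = \sum_w const (c w) *: twisted_act tau w phi.
Proof.
rewrite raddf_sum; apply: eq_bigr => w _.
by rewrite /= act_onM act_on_fun [act_on phi _]DW_act_grp.
Qed.

Lemma act_on_dunkl phi xi : act_on phi (dunkl alpha k xi) =
  dmx xi phi - \sum_H dlog_form alpha H xi *: \sum_(i < nstab H)
    (\sum_w const (idem_coef H i w) *: twisted_act tau w phi) *~ kz_weight k H i.
Proof.
rewrite raddfB /= [act_on phi _]DW_act_partial; congr (_ - _).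
rewrite raddf_sum; apply: eq_bigr => H _; rewrite /= act_onM act_on_fun.
congr (_ *: _); rewrite [LHS](raddf_sum (act_on phi)); apply: eq_bigr => i _ /=.
by rewrite -act_on_grpalg -raddfMz.
Qed.

Variables (m' : nat) (tau' : mx_representation C [set: gT] m').
Variable X : 'M[Creg]_(m, m').
Hypothesis X_equiv : forall w, cmx (tau w) *m map_mx (creg_act w) X = X *m cmx (tau' w).
Hypothesis X_flat : forall xi, dmx xi X = X *m kz_matrix alpha k tau' xi.

Lemma grp_equivariant w (u : 'cV[C]_m') :
  twisted_act tau w (X *m cmx u) = X *m cmx (tau' w *m u).
Proof.
rewrite /twisted_act map_mxM mulmxA X_equiv -mulmxA; congr (_ *m _).
have -> : map_mx (creg_act w) (cmx u) = cmx u.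
  by apply/matrixP => i j; rewrite !mxE creg_act_const.
by rewrite map_mxM.
Qed.

(** By equivariance the group acts on [X u] through [tau'], so the reflection part of the Dunkl
    operator becomes [X A u], which is the derivative of [X u]. *)
Lemma dunkl_kills xi (u : 'cV[C]_m') : act_on (X *m cmx u) (dunkl alpha k xi) = 0.
Proof.
rewrite act_on_dunkl dmxM dmx_const mulmx0 addr0 X_flat.
apply/eqP; rewrite subr_eq0; apply/eqP; rewrite /kz_matrix mulmx_sumr mulmx_suml.
apply: eq_bigr => H _; rewrite -scalemxAr -scalemxAl; congr (_ *: _).
rewrite /residue raddf_sum mulmx_sumr mulmx_suml; apply: eq_bigr => i _ /=.
rewrite raddfMz /= -!scaler_int -scalemxAr -scalemxAl; congr (_ *: _).
rewrite /rep_idem raddf_sum mulmx_sumr mulmx_suml; apply: eq_bigr => w _ /=.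
by rewrite grp_equivariant map_mxZ -scalemxAr -scalemxAl map_mxM mulmxA.
Qed.

Local Notation M := (standard_module alpha k tau').
Local Notation RM := (reg_module alpha k tau).

Definition row_map (x : 'rV[Hk]_m') : RM := \sum_j x 0 j *: (col j X : RM).

Lemma row_map_linear : linear row_map.
Proof.
move=> a x y; rewrite /row_map scaler_sumr -big_split; apply: eq_bigr => j _ /=.
by rewrite !mxE scalerDl scalerA.
Qed.

Lemma row_map_tensor (h : Hk) (u : 'cV[C]_m') :
  row_map (pure_tensor h u) = h *: (X *m cmx u : RM).
Proof.
have -> : X *m cmx u = \sum_j Hk_poly alpha k (u j 0)%:MP *: (col j X : RM) :> RM.
  apply/matrixP => i j; rewrite ord1 !mxE summxE; apply: eq_bigr => l _.
  have -> : Hk_poly alpha k (u l 0)%:MP *: (col l X : RM) = const (u l 0) *: col l X.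
    exact: DW_act_fun.
  by rewrite !mxE mulrC.
by rewrite scaler_sumr; apply: eq_bigr => j _; rewrite mxE scalerA.
Qed.

Lemma row_map_span x : submod_span (standard_rel tau') x -> row_map x = 0.
Proof.
elim=> {x} [x|//|a x y _ hx _ hy].
- case=> [[w [u ->]]|[xi [u ->]]].
    rewrite -scaleN1r addrC row_map_linear !row_map_tensor scale1r scaleN1r.
    have -> : Hk_grp alpha k w *: (X *m cmx u : RM) = twisted_act tau w (X *m cmx u).
      exact: DW_act_grp.
    by rewrite grp_equivariant addNr.
  by rewrite row_map_tensor; exact: dunkl_kills.
- by rewrite /row_map big1 // => j _; rewrite mxE scale0r.
- by rewrite row_map_linear hx hy scaler0 addr0.
Qed.

(** Uses a chosen representative; independence of the choice comes from [row_map_span]. *)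
Definition standard_map (x : M) : RM := row_map (generic_quotient.repr x).

Lemma standard_map_proj x : standard_map (qm_proj (standard_rel tau') x) = row_map x.
Proof.
rewrite /standard_map; set y := generic_quotient.repr _.
have E : submod_span (standard_rel tau') (y - x) by apply/qm_projP; rewrite qm_repr.
have := row_map_span E; rewrite addrC -scaleN1r row_map_linear scaleN1r => /eqP.
by rewrite addrC subr_eq0 => /eqP.
Qed.

Lemma standard_map_linear : linear standard_map.
Proof.
move=> a x y; rewrite -[x]qm_repr -[y]qm_repr -linearP !standard_map_proj.
exact: row_map_linear.
Qed.
HB.instance Definition _ := GRing.isLinear.Build Hk M RM *:%R standard_map
  standard_map_linear.

Lemma standard_map_poly (p : 'cV[CV]_m') :
  standard_map (\sum_j Hk_poly alpha k (p j 0) *: std_gen alpha k tau' j) = X *m map_mx cp p.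
Proof.
rewrite raddf_sum /=; apply/matrixP => i j; rewrite ord1 !mxE summxE; apply: eq_bigr => l _.
rewrite linearZ /= /std_gen standard_map_proj.
have -> : row_map (delta_mx 0 l) = col l X.
  rewrite /row_map (bigD1 l) //= big1 => [|h /negPf hl]; last by rewrite mxE hl scale0r.
  by rewrite mxE !eqxx scale1r addr0.
have -> : Hk_poly alpha k (p l 0) *: (col l X : RM) = cp (p l 0) *: col l X.
  exact: DW_act_fun.
by rewrite !mxE mulrC.
Qed.
End DunklAction.

Theorem quasi_invariants_standard (C : fieldType) (n : nat) (gT : finGroupType)
    (W : mx_representation C [set: gT] n)
    (alpha : defining_forms W) (k : multiplicity W)
    (m m' : nat)
    (tau : mx_representation C [set: gT] m)
    (tau' : mx_representation C [set: gT] m') :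
  [pchar C] =i pred0 -> mx_faithful W -> is_kz alpha k tau' tau ->
  exists f : {linear standard_module alpha k tau' -> reg_module alpha k tau},
    injective f /\
    forall phi : reg_module alpha k tau,
      quasi_invariant phi <-> exists x, f x = phi.
Proof.
move=> char0 faithfulW [mm' [Y [Y_inj Y_sol Y_act]]]; subst m'.
have Y_flat xi : map_mx (creg_partial xi) Y = - kz_matrix alpha k tau' xi *m Y.
  apply: (mulmx_delta_inj (c := creg_const alpha)) => u.
  have /kz_solutionE /(_ xi) : kz_solution k tau' (Y *m map_mx (creg_const alpha) u).
    by apply/Y_sol; exists u.
  by rewrite dmxM dmx_const mulmx0 addr0 mulmxA.
have Y_equiv w : map_mx (creg_const alpha) (tau' w) *m map_mx (creg_act w) Y =
    Y *m map_mx (creg_const alpha) (tau w).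
  apply: (mulmx_delta_inj (c := creg_const alpha)) => u.
  have := Y_act w u; rewrite /twisted_act map_mxM mulmxA => ->.
  rewrite map_mxM -!mulmxA; do 2 congr (_ *m _).
  by apply/matrixP => i j; rewrite !mxE /= creg_act_const.
have [X [YX XY]] := fundamental_inverse char0 faithfulW Y_inj Y_flat.
have X_equiv := inverse_equiv Y_equiv YX XY.
have X_flat := inverse_flat Y_flat YX XY.
pose f : standard_module alpha k tau' -> reg_module alpha k tau := standard_map tau X.
have f_poly := standard_map_poly X_equiv X_flat.
exists (HB.pack_for {linear standard_module alpha k tau' -> reg_module alpha k tau}
  f (GRing.isLinear.Build _ _ _ _ _ (standard_map_linear X_equiv X_flat))).
split=> [x y /= E|phi].
  (* The difference is the class of a polynomial vector [p], which is mapped to [X p];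
     multiplication by [Y] gives [p = 0]. *)
  apply/eqP; rewrite -subr_eq0; apply/eqP; have [p Ep] := standard_module_span char0 (x - y).
  rewrite Ep; suff -> : p = 0.
    by rewrite big1 // => j _; rewrite mxE raddf0 scale0r.
  have : X *m map_mx (creg_poly alpha) p = 0.
    rewrite -f_poly -Ep addrC -scaleN1r (standard_map_linear X_equiv X_flat).
    by rewrite -/f E scaleN1r addNr.
  move=> /(congr1 (mulmx Y)); rewrite mulmxA YX mul1mx mulmx0 => E0.
  apply/matrixP => i j; apply: (@creg_poly_inj _ _ _ _ alpha).
  by have /matrixP /(_ i j) := E0; rewrite !mxE rmorph0.
(* It remains to compare with the image [X C[V]^m]: [Y phi = p] is the same as [phi = X p]. *)
apply: (iff_trans (quasi_invariant_poly char0 faithfulW Y_flat Y_equiv YX XY phi)).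
split=> [[p Ep]|[x Ex]].
  exists (\sum_j Hk_poly alpha k (p j 0) *: std_gen alpha k tau' j).
  by rewrite -[LHS]/(standard_map tau X _) f_poly -Ep mulmxA XY mul1mx.
have {}Ex : standard_map tau X x = phi by [].
have [p Ep] := standard_module_span char0 x; exists p.
by rewrite -Ex Ep f_poly mulmxA YX mul1mx.
Qed.

Theorem proposition7p13 (R : realType) (n : nat) (gT : finGroupType)
    (W : mx_representation R[i] [set: gT] n)
    (alpha : defining_forms W) (k : multiplicity W)
    (m m' : nat)
    (tau : mx_representation R[i] [set: gT] m)
    (tau' : mx_representation R[i] [set: gT] m') :
  mx_faithful W -> generated_by_reflections W ->
  invariant_multiplicity k ->
  mx_irreducible tau -> mx_irreducible tau' ->
  is_kz alpha k tau' tau ->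
  exists f : {linear standard_module alpha k tau' -> reg_module alpha k tau},
    injective f /\
    forall phi : reg_module alpha k tau,
      quasi_invariant phi <-> exists x, f x = phi.
Proof.
move=> faithfulW _ _ _ _; apply: quasi_invariants_standard => //.
exact: Num.Theory.pchar_num.
Qed.
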